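(* Let $k$ be a field and let $I$ be an ideal in the polynomial ring $k[x,y]$ which is generated by monomials of degree $d\ge 2$. Assume that $x^d,\ x^{d-1}y,\ y^d\in I$. Then $$\operatorname{reg}R(I)=\operatorname{reg}F(I).$$
   Context: All monomial generators of $I$ have the same degree $d$. Let $\mathfrak m=(x,y)$. $R(I)=\bigoplus_{n\ge 0}I^n$ is the Rees algebra (standard graded over $k[x,y]$) and $F(I)=\bigoplus_{n\ge 0}I^n/\mathfrak mI^n$ is the fiber ring (standard graded over $k$). For a standard graded algebra $R$ over a commutative ring, with $R_+$ the ideal generated by elements of positive degree, put $a_i(R)=\max\{n\mid H^i_{R_+}(R)_n\ne 0\}$ ($-\infty$ if $H^i_{R_+}(R)=0$) and $\operatorname{reg}R=\max\{a_i(R)+i\mid i\ge 0\}$. *)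

(* Defs.v *)
From HB Require Import structures.
From mathcomp Require Import all_boot all_order all_algebra ring_quotient.
From mathcomp Require Import boolp classical_sets.
From mathcomp Require Import mpoly.

Set Implicit Arguments.
Unset Strict Implicit.
Unset Printing Implicit Defensive.

Import Order.TTheory GRing.Theory Num.Theory.
Local Open Scope classical_set_scope.
Local Open Scope ring_scope.

Section Ideals.
Variable A : comNzRingType.
Implicit Types (S I J : set A).

Definition ideal_gen S : set A :=
  [set a | exists s : seq (A * A),
     (forall p, p \in s -> S p.2) /\ a = \sum_(p <- s) p.1 * p.2].

Definition ideal_mul I J : set A :=
  ideal_gen [set c | exists a b, [/\ I a, J b & c = a * b]].

Definition ideal_pow I (n : nat) : set A := iter n (ideal_mul I) setT.

Lemma ideal_gen0 S : ideal_gen S 0.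
Proof. by exists [::]; rewrite big_nil. Qed.

Lemma ideal_genD S a b : ideal_gen S a -> ideal_gen S b -> ideal_gen S (a + b).
Proof.
move=> [s [hs ->]] [t [ht ->]]; exists (s ++ t); rewrite big_cat; split=> // p.
by rewrite mem_cat => /orP[/hs|/ht].
Qed.

Lemma ideal_genM S a b : ideal_gen S b -> ideal_gen S (a * b).
Proof.
move=> [s [hs ->]]; exists [seq (a * p.1, p.2) | p <- s]; split.
  by move=> p /mapP[q /hs hq ->].
by rewrite big_map mulr_sumr; apply: eq_bigr => p _; rewrite mulrA.
Qed.

Lemma ideal_genN S a : ideal_gen S a -> ideal_gen S (- a).
Proof. by rewrite -mulN1r; apply: ideal_genM. Qed.

Lemma ideal_gen_sum S (T : Type) (r : seq T) (P : pred T) (F : T -> A) :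
  (forall i, P i -> ideal_gen S (F i)) -> ideal_gen S (\sum_(i <- r | P i) F i).
Proof.
move=> h; elim/big_ind: _ => //; [exact: ideal_gen0 | exact: ideal_genD].
Qed.

Lemma ideal_gen_mem S a : S a -> ideal_gen S a.
Proof.
move=> Sa; exists [:: (1, a)]; rewrite big_seq1 mul1r; split=> // p.
by rewrite inE => /eqP ->.
Qed.

Lemma ideal_mul_mem I J a b : I a -> J b -> ideal_mul I J (a * b).
Proof. by move=> Ia Jb; apply: ideal_gen_mem; exists a, b. Qed.

Lemma ideal_pow0 I n : ideal_pow I n 0.
Proof. by case: n => // n; apply: ideal_gen0. Qed.

Lemma ideal_powD I n a b :
  ideal_pow I n a -> ideal_pow I n b -> ideal_pow I n (a + b).
Proof. by case: n => // n; apply: ideal_genD. Qed.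

Lemma ideal_powN I n a : ideal_pow I n a -> ideal_pow I n (- a).
Proof. by case: n => // n; apply: ideal_genN. Qed.

Lemma ideal_powMl I n a b : ideal_pow I n b -> ideal_pow I n (a * b).
Proof. by case: n => // n; apply: ideal_genM. Qed.

Lemma ideal_pow_sum I n (T : Type) (r : seq T) (P : pred T) (F : T -> A) :
  (forall i, P i -> ideal_pow I n (F i)) ->
  ideal_pow I n (\sum_(i <- r | P i) F i).
Proof.
move=> h; elim/big_ind: _ => //; [exact: ideal_pow0 | exact: ideal_powD].
Qed.

Lemma ideal_powM I m n a b :
  ideal_pow I m a -> ideal_pow I n b -> ideal_pow I (m + n)%N (a * b).
Proof.
elim: m a => [|m IH] a; first by move=> _; apply: ideal_powMl.
move=> [s [hs ->]] hb; rewrite mulr_suml big_seq_cond.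
apply: ideal_gen_sum => p /andP[/hs [c [e [Ic he ->]]] _].
by rewrite -!mulrA; apply: ideal_genM; apply: ideal_mul_mem => //; apply: IH.
Qed.

End Ideals.

(* V is the internal direct sum of its subgroups C n *)
Definition direct_sum (V : zmodType) (C : int -> set V) : Prop :=
  [/\ forall n, C n 0,
      forall n u v, C n u -> C n v -> C n (u - v),
      forall v, exists (s : seq int) (c : int -> V),
        (forall n, C n (c n)) /\ v = \sum_(n <- s) c n
    & forall (s : seq int) (c : int -> V), uniq s -> (forall n, C n (c n)) ->
        \sum_(n <- s) c n = 0 -> forall n, n \in s -> c n = 0].

(* an N-grading seen as a Z-grading vanishing in negative degrees *)
Definition int_comp (V : zmodType) (C : nat -> set V) (n : int) : set V :=
  if n is Posz m then C m else [set 0].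

Record graded_ring := GradedRing {
  gr_sort :> comNzRingType;
  gr_comp : nat -> set gr_sort;
  gr_one : gr_comp 0%N 1;
  gr_mul : forall m n a b,
    gr_comp m a -> gr_comp n b -> gr_comp (m + n)%N (a * b);
  gr_sum : direct_sum (int_comp gr_comp) }.
Arguments gr_comp : clear implicits.

Record graded_module (A : graded_ring) := GradedModule {
  gm_sort :> lmodType A;
  gm_comp : int -> set gm_sort;
  gm_act : forall (m : nat) (n : int) a v,
    gr_comp A m a -> gm_comp n v -> gm_comp (m%:Z + n) (a *: v);
  gm_sum : direct_sum gm_comp }.
Arguments gm_comp {A} _ _.

Section LocalCohomology.
Variable A : graded_ring.

Lemma regular_act (m : nat) (n : int) (a : A) (v : A^o) :
  gr_comp A m a -> int_comp (gr_comp A) n v ->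
  int_comp (gr_comp A) (m%:Z + n) (a *: v).
Proof.
case: n => n ha /= hv; first exact: gr_mul.
rewrite hv scaler0; have [h _ _ _] := gr_sum A; exact: h.
Qed.

Definition regular_module : graded_module A :=
  @GradedModule A A^o (int_comp (gr_comp A)) regular_act (gr_sum A).

Definition graded_hom (U V : graded_module A) (f : {linear U -> V}) : Prop :=
  forall n u, gm_comp U n u -> gm_comp V n (f u).

(* injective objects of the category of graded A-modules and homogeneous
   A-linear maps of degree 0 *)
Definition graded_injective (E : graded_module A) : Prop :=
  forall (U W : graded_module A) (i : {linear U -> W}) (f : {linear U -> E}),
    graded_hom i -> injective i -> graded_hom f ->
    exists g : {linear W -> E}, graded_hom g /\ forall u, g (i u) = f u.

Record injective_resolution (M : graded_module A) := InjectiveResolution {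
  ir_term :> nat -> graded_module A;
  ir_inj : forall i, graded_injective (ir_term i);
  ir_aug : {linear M -> ir_term 0%N};
  ir_aug_hom : graded_hom ir_aug;
  ir_aug_inj : injective ir_aug;
  ir_diff : forall i, {linear ir_term i -> ir_term i.+1};
  ir_diff_hom : forall i, graded_hom (ir_diff i);
  ir_exact0 : forall v, ir_diff 0%N v = 0 <-> exists u, ir_aug u = v;
  ir_exactS : forall i v, ir_diff i.+1 v = 0 <-> exists u, ir_diff i u = v }.
Arguments ir_diff {M} _ i.

Definition irrelevant_ideal : set A :=
  ideal_gen [set a | exists2 n, (0 < n)%N & gr_comp A n a].

(* the torsion functor Gamma_J with J = A_+ *)
Definition torsion (V : graded_module A) : set V :=
  [set v | exists t, forall a, ideal_pow irrelevant_ideal t a -> a *: v = 0].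

(* The local cohomology of M with support in A_+ is the right derived functor
   of Gamma at M, i.e. the cohomology of Gamma(E) for any graded injective
   resolution E of M; the predicate says that its i-th module is nonzero in
   degree n. *)
Definition coboundary M (E : injective_resolution M) (i : nat) (n : int) :
    set (E i) :=
  match i return set (E i) with
  | 0 => [set 0]
  | j.+1 => [set v | exists w, [/\ torsion w, gm_comp (E j) n w
                                 & ir_diff E j w = v]]
  end.

Definition lc_neq0 M (E : injective_resolution M) (i : nat) (n : int) : Prop :=
  exists v : E i, [/\ torsion v, gm_comp (E i) n v, ir_diff E i v = 0
                    & ~ coboundary n v].

(* maximum of a set of integers, with None standing for -oo = max of set0 *)
Definition is_max (S : set int) (o : option int) : Prop :=
  if o is Some m then S m /\ forall n, S n -> n <= m else S = set0.

Definition is_a_invariant (E : injective_resolution regular_module) (i : nat)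
    (o : option int) : Prop := is_max [set n | lc_neq0 E i n] o.

(* r = reg A, computed with E; the indices i with a i = -oo do not contribute
   to the maximum of the a i + i *)
Definition is_regularity (E : injective_resolution regular_module)
    (r : option int) : Prop :=
  exists a : nat -> option int, (forall i, is_a_invariant E i (a i)) /\
    is_max [set m | exists i n, a i = Some n /\ m = n + i%:Z] r.

End LocalCohomology.

Section Rees.
Variables (A : comNzRingType) (I : set A).

Definition rees_pred : {pred {poly A}} :=
  fun p => `[< forall n, ideal_pow I n p`_n >].

Lemma rees_predP (p : {poly A}) :
  reflect (forall n, ideal_pow I n p`_n) (p \in rees_pred).
Proof. exact: asboolP. Qed.

Lemma rees_subring_closed : subring_closed rees_pred.
Proof.
split.
- apply/rees_predP => -[|n] //; rewrite coef1; exact: ideal_pow0.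
- move=> p q /rees_predP hp /rees_predP hq; apply/rees_predP => n.
  by rewrite coefB; apply: ideal_powD => //; apply: ideal_powN.
- move=> p q /rees_predP hp /rees_predP hq; apply/rees_predP => n.
  rewrite coefM; apply: ideal_pow_sum => i _.
  have {1}-> : n = (i + (n - i))%N by rewrite subnKC // -ltnS.
  exact: ideal_powM.
Qed.

HB.instance Definition _ := GRing.isSubringClosed.Build _ rees_pred
  rees_subring_closed.

(* the direct sum of the I^n, as the subring of A['X] of the polynomials whose
   n-th coefficient lies in I^n *)
Record rees_algebra := Rees { rees_val : {poly A}; _ : rees_pred rees_val }.

HB.instance Definition _ := [isSub for rees_val].
HB.instance Definition _ := [Choice of rees_algebra by <:].
HB.instance Definition _ :=
  [SubChoice_isSubComNzRing of rees_algebra by <:].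

Local Notation rv p := (val (p : rees_algebra) : {poly A}).

Definition rees_comp (n : nat) : set rees_algebra :=
  [set p | forall m, m != n -> (rv p)`_m = 0].

Lemma rees_coef (p : rees_algebra) n : ideal_pow I n (rv p)`_n.
Proof. by case: p => p /= /rees_predP. Qed.

Lemma rees_val0 : rv 0 = 0.
Proof. exact: (rmorph0 (val : {rmorphism _ -> _})). Qed.

Lemma rees_comp1 : rees_comp 0%N 1.
Proof. by move=> m m0; rewrite rmorph1 coef1 (negbTE m0). Qed.

Lemma rees_compM m n p q :
  rees_comp m p -> rees_comp n q -> rees_comp (m + n)%N (p * q).
Proof.
move=> hp hq l hl; rewrite rmorphM coefM big1 // => i _.
have [im|/hp ->] := eqVneq (i : nat) m; last by rewrite mul0r.
rewrite (hq (l - i)%N) ?mulr0 //; apply: contra_neq hl => <-.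
by rewrite -im subnKC // -ltnS.
Qed.

Definition rees_proj (p : rees_algebra) (n : int) : rees_algebra :=
  insubd 0 (if n is Posz m then (rv p)`_m *: 'X^m else 0).

Lemma rees_projE p n :
  rv (rees_proj p n) = if n is Posz m then (rv p)`_m *: 'X^m else 0.
Proof.
rewrite insubdK //; apply/rees_predP => i; case: n => n.
  rewrite coefZ coefXn; have [->|_] := eqVneq i n.
    by rewrite mulr1; apply: rees_coef.
  by rewrite mulr0; apply: ideal_pow0.
by rewrite coef0; apply: ideal_pow0.
Qed.

Lemma rees_proj_comp p n : int_comp rees_comp n (rees_proj p n).
Proof.
case: n => n /=; last by apply: val_inj; rewrite rees_projE rees_val0.
by move=> m mn; rewrite rees_projE coefZ coefXn (negbTE mn) mulr0.
Qed.

Lemma rees_proj_sum p :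
  p = \sum_(n <- [seq Posz i | i <- index_iota 0 (size (rv p))]) rees_proj p n.
Proof.
apply: val_inj; rewrite raddf_sum big_map -{1}[rv p]coefK poly_def.
rewrite big_mkord.
apply: eq_bigr => i _; exact/esym/rees_projE.
Qed.

Lemma rees_comp_coef n p m :
  int_comp rees_comp n p -> n != Posz m -> (rv p)`_m = 0.
Proof.
case: n => n /= h nm; last by rewrite h rees_val0 coef0.
by apply: h; rewrite eq_sym.
Qed.

Lemma rees_sum : direct_sum (int_comp rees_comp).
Proof.
split.
- by move=> [n|n] //= m _; rewrite rees_val0 coef0.
- move=> [n|n] u v /=; last by move=> -> ->; rewrite subr0.
  by move=> hu hv m mn; rewrite rmorphB coefB hu // hv // subr0.
- move=> p; exists [seq Posz i | i <- index_iota 0 (size (rv p))], (rees_proj p).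
  by split; [exact: rees_proj_comp | exact: rees_proj_sum].
- move=> s c us hc h0 n ns; apply: val_inj; rewrite rees_val0.
  apply/polyP => m; rewrite coef0.
  have [nm|] := eqVneq n (Posz m); last exact: rees_comp_coef.
  have := congr1 (fun p : rees_algebra => (rv p)`_m) h0.
  rewrite rees_val0 coef0 raddf_sum coef_sum (bigD1_seq n) //= big1 ?addr0 //.
  by move=> i ni; apply: (rees_comp_coef (hc i)); rewrite -nm.
Qed.

Definition rees : graded_ring :=
  GradedRing rees_comp1 rees_compM rees_sum.

End Rees.

Section Fiber.
Variable k : fieldType.
Local Notation A := {mpoly k[2]}.
Local Notation rv p := (val (p : rees_algebra _) : {poly A}).

Definition vx : A := 'X_ord0.
Definition vy : A := 'X_ord_max.

Definition maxideal : set A := ideal_gen [set vx; vy].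

Variable I : set A.

(* the direct sum of the m I^n inside that of the I^n, so that the quotient is
   the direct sum of the I^n / m I^n *)
Definition fiber_pred : {pred rees_algebra I} :=
  fun p => `[< forall n, ideal_mul maxideal (ideal_pow I n) (rv p)`_n >].

Lemma fiber_predP (p : rees_algebra I) :
  reflect (forall n, ideal_mul maxideal (ideal_pow I n) (rv p)`_n)
          (p \in fiber_pred).
Proof. exact: asboolP. Qed.

Lemma maxideal_eval0 (a : A) : maxideal a -> a.@[fun=> 0] = 0.
Proof.
move=> [s [hs ->]]; rewrite rmorph_sum big_seq big1 // => p /hs.
by rewrite rmorphM => -[] /= ->; rewrite mevalXU mulr0.
Qed.

Lemma ideal_mul_powM J m n (a b : A) :
  ideal_pow I m a -> ideal_mul J (ideal_pow I n) b ->
  ideal_mul J (ideal_pow I (m + n)%N) (a * b).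
Proof.
move=> ha [s [hs ->]]; rewrite mulr_sumr big_seq_cond.
apply: ideal_gen_sum => p /andP[/hs [c [e [Jc he ->]]] _].
rewrite mulrCA; apply: ideal_genM; rewrite mulrCA.
by apply: ideal_mul_mem => //; apply: ideal_powM.
Qed.

Lemma fiber_idealr_closed : idealr_closed fiber_pred.
Proof.
split.
- by apply/fiber_predP => n; rewrite rees_val0 coef0; apply: ideal_gen0.
- apply/fiber_predP => /(_ 0%N) [s [hs]]; rewrite rmorph1 coef1 /=.
  move=> /(congr1 (meval (fun=> 0))); rewrite rmorph1 rmorph_sum big_seq big1.
    by move/eqP; rewrite oner_eq0.
  move=> p /hs [c [e [hc _ ->]]].
  by rewrite !rmorphM /= (maxideal_eval0 hc) mul0r mulr0.
- move=> a p q /fiber_predP hp /fiber_predP hq; apply/fiber_predP => n.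
  rewrite rmorphD rmorphM coefD coefM; apply: ideal_genD; last exact: hq.
  apply: ideal_gen_sum => i _.
  have {1}-> : n = (i + (n - i))%N by rewrite subnKC // -ltnS.
  by apply: ideal_mul_powM => //; apply: rees_coef.
Qed.

HB.instance Definition _ :=
  isIdealr.Build (rees_algebra I) fiber_pred fiber_idealr_closed.

Definition fiber_ring : comNzRingType := {ideal_quot fiber_pred}.

Definition fiber_proj : {rmorphism rees I -> fiber_ring} :=
  \pi_({ideal_quot fiber_pred})%qT.

Lemma fiber_proj_surj (q : fiber_ring) : exists p, fiber_proj p = q.
Proof. by exists (repr q); rewrite [LHS]reprK. Qed.

Lemma fiber_proj0 (p : rees I) : fiber_proj p = 0 <-> p \in fiber_pred.
Proof.
rewrite -{1}(rmorph0 fiber_proj); split=> [/eqP|h]; last apply/eqP.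
  by rewrite -Quotient.idealrBE subr0.
by rewrite -Quotient.idealrBE subr0.
Qed.

Definition fiber_comp (n : nat) : set fiber_ring :=
  [set q | exists2 p, rees_comp n p & fiber_proj p = q].

Lemma fiber_comp1 : fiber_comp 0%N 1.
Proof. by exists 1; [exact: rees_comp1 | rewrite rmorph1]. Qed.

Lemma fiber_compM m n a b :
  fiber_comp m a -> fiber_comp n b -> fiber_comp (m + n)%N (a * b).
Proof.
move=> [p hp <-] [q hq <-]; exists (p * q); last by rewrite rmorphM.
exact: rees_compM.
Qed.

Lemma int_fiber_compP n q :
  int_comp fiber_comp n q <->
  exists2 p : rees I, int_comp (@rees_comp _ I) n p & fiber_proj p = q.
Proof.
case: n => n //=; split=> [->|[p -> <-]]; last by rewrite rmorph0.
by exists 0; rewrite ?rmorph0.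
Qed.

Lemma fiber_sum : direct_sum (int_comp fiber_comp).
Proof.
have [s0 sB sE sI] := rees_sum I.
split.
- by move=> n; apply/int_fiber_compP; exists 0; [exact: s0 | rewrite rmorph0].
- move=> n u v /int_fiber_compP[p hp <-] /int_fiber_compP[q hq <-].
  by apply/int_fiber_compP; exists (p - q); [exact: sB | rewrite rmorphB].
- move=> q; have [p <-] := fiber_proj_surj q; have [s [c [hc ->]]] := sE p.
  exists s, (fun n => fiber_proj (c n)); split; last by rewrite rmorph_sum.
  by move=> n; apply/int_fiber_compP; exists (c n).
- move=> s c us hc h0 n ns.
  have /choice[e he] : forall i, exists p : rees I,
      int_comp (@rees_comp _ I) i p /\ fiber_proj p = c i.
    by move=> i; have /int_fiber_compP[p hp <-] := hc i; exists p.
  rewrite -(he n).2; apply/fiber_proj0/fiber_predP => m.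
  have [nm|] := eqVneq n (Posz m); last first.
    by move=> /(rees_comp_coef (he n).1) ->; apply: ideal_gen0.
  have : fiber_proj (\sum_(i <- s) e i) = 0.
    by rewrite rmorph_sum -[RHS]h0; apply: eq_bigr => i _; exact: (he i).2.
  move=> /fiber_proj0/fiber_predP/(_ m).
  rewrite raddf_sum coef_sum (bigD1_seq n) //= big1 ?addr0 //.
  by move=> i ni; apply: (rees_comp_coef (he i).1); rewrite -nm.
Qed.

Definition fiber : graded_ring :=
  GradedRing fiber_comp1 fiber_compM fiber_sum.

End Fiber.

(* Main.v *)
Require Import Defs.
From HB Require Import structures.
From mathcomp Require Import all_boot all_order all_algebra.
From mathcomp Require Import boolp classical_sets.
From mathcomp Require Import mpoly zify ring.

Set Implicit Arguments.
Unset Strict Implicit.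
Unset Printing Implicit Defensive.

Import Order.TTheory GRing.Theory Num.Theory.
Local Open Scope classical_set_scope.
Local Open Scope ring_scope.

(** The regularity only records in which degrees the local cohomology lives,
and for both algebras these degrees can be read off from the same set of
integers.

Let B be the set of the exponents of y in the monomial generators of I and nB
its n-fold sumset ([sumset]); the hypotheses say that 0, 1 and d lie in B. In
degree n, the fiber ring has as a basis the monomials x^p y^q with p + q = nd
and q in nB ([fiber_exp]), and the Rees algebra has the monomials that are
divisible by one of these ([rees_exp]).

The elements a = x^d and b = y^d of degree one generate an ideal that
contains all elements of large degree, so local cohomology can be computed by
the Cech complex A -> A_a + A_b -> A_ab. Since the statement speaks of an
arbitrary graded injective resolution, this is proved by hand: over an
injective module E with torsion submodules G_c(E), the sequence 0 ->
G_(a,b)(E) -> G_a(E) + G_b(E) -> G_ab(E) -> 0 is exact ([injective_split]),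
and E is divisible by homogeneous regular elements ([injective_divisible]).
The exactness on the right comes from the fact that a fraction of large
degree which has both a power of a and a power of b as denominator lies in A
([cech_pair]). A diagram chase then identifies H^1 and H^2 with Cech
cohomology ([lc1_cech], [lc2_cech]) and shows that the other H^i vanish.

On monomials, the Cech cohomology becomes a question about B:
- H^1 is nonzero in degree n when some monomial is missing from degree n
  although it is the quotient of an element by a power of a, and by a power
  of b ([sat_gap]). A missing monomial of the Rees algebra gives one of
  degree exactly nd, so in degrees n >= 0 both algebras have the same gaps
  ([sat_gap_fiber_rees]).
- H^2 is nonzero in degree n >= 0 exactly when some i > nd lies outside of
  the numerical semigroup generated by the d - j with j in B; this criterion
  is the same for both algebras ([end_gap_rees], [end_gap_fiber]). This uses
  that 1 is in B, by which every j >= 0 is an exponent after inverting a.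

Both vanish in degrees above d^2: H^1 because nB contains, for large n, all
the integers that its two ends allow ([sumset_saturated]), and H^2 because
the semigroup contains all large integers ([end_semigroup_large]).

In negative degrees H^1 differs: the inverse of the Rees variable is a class
of degree -1. But x^(d-1) y gives a nonzero class in H^2 of degree -1 for
both algebras, so that both regularities are at least 1, and a negative
degree of H^1 contributes at most 0 ([regularity_transfer]). *)

(** * Homogeneous decompositions *)

Section Decomposition.
Variables (V : zmodType) (C : int -> set V).

(** Relating v to its family of components, rather than naming a projection,
lets components be computed by exhibiting any decomposition ([decomp_uniq]). *)
Definition decomp (v : V) (f : int -> V) : Prop :=
  (forall n, C n (f n)) /\
  exists s : seq int, [/\ uniq s, forall n, n \notin s -> f n = 0
                        & v = \sum_(n <- s) f n].

Hypothesis hC : direct_sum C.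

Let C0 n : C n 0. Proof. by have [h _ _ _] := hC. Qed.
Let CB n u v : C n u -> C n v -> C n (u - v).
Proof. by have [_ h _ _] := hC; apply: h. Qed.
Let CD n u v : C n u -> C n v -> C n (u + v).
Proof. by move=> hu hv; rewrite -[v]opprK -[- v]add0r; apply/CB/CB. Qed.

Lemma sum_widen (f : int -> V) (s s' : seq int) :
  uniq s -> uniq s' -> {subset s <= s'} -> (forall n, n \notin s -> f n = 0) ->
  \sum_(n <- s') f n = \sum_(n <- s) f n.
Proof.
move=> us us' ss' f0.
rewrite (bigID (mem s)) /= addrC big1 ?add0r; last by move=> n /f0.
rewrite -big_filter; apply: perm_big; apply: uniq_perm => //.
  exact: filter_uniq.
by move=> n; rewrite mem_filter; case: (boolP (n \in s)) => // /ss' ->.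
Qed.

(** The sequence of degrees given by [direct_sum] may have repetitions, which
are collected into one component. *)
Lemma decomp_exists v : exists f, decomp v f.
Proof.
have [_ _ sE _] := hC; have [s [c [hc ->]]] := sE v.
exists (fun n => c n *+ count_mem n s); split.
  by move=> n; elim: (count_mem n s) => [|m]; rewrite ?mulr0n // mulrS;
    exact: CD.
exists (undup s); split; first exact: undup_uniq.
  by move=> n; rewrite mem_undup => /count_memPn ->.
by rewrite -[LHS]big_undup_iterop_count; apply: eq_bigr => n _.
Qed.

Lemma decompB u v f g :
  decomp u f -> decomp v g -> decomp (u - v) (fun n => f n - g n).
Proof.
move=> [hf [s [us f0 ->]]] [hg [t [ut g0 ->]]]; split.
  by move=> n; apply: CB.
exists (undup (s ++ t)); split; first exact: undup_uniq.
  by move=> n; rewrite mem_undup mem_cat negb_or => /andP[/f0-> /g0->];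
    rewrite subr0.
rewrite sumrB; congr (_ - _).
  by rewrite (sum_widen us) ?undup_uniq // => n;
    rewrite mem_undup mem_cat => ->.
by rewrite (sum_widen ut) ?undup_uniq // => n;
  rewrite mem_undup mem_cat orbC => ->.
Qed.

Lemma decomp_single n v : C n v -> decomp v (fun i => if i == n then v else 0).
Proof.
move=> hv; split=> [i|]; first by case: eqP => [->|].
exists [:: n]; split=> //; last by rewrite big_seq1 eqxx.
by move=> i; rewrite inE => /negbTE ->.
Qed.

Lemma decomp0 : decomp 0 (fun _ => 0).
Proof. by split=> [i|]; [exact: C0 | exists [::]; rewrite big_nil]. Qed.

Lemma decomp0P v f : decomp v f -> (forall n, f n = 0) -> v = 0.
Proof. by move=> [_ [s [_ _ ->]]] f0; rewrite big1. Qed.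

Lemma decomp_eq0 f : decomp 0 f -> forall n, f n = 0.
Proof.
move=> [hf [s [us f0 s0]]] n; have [_ _ _ sI] := hC.
by case: (boolP (n \in s)) => [|/f0 //]; apply: (sI s f).
Qed.

Lemma decomp_uniq v f g : decomp v f -> decomp v g -> f =1 g.
Proof.
move=> hf hg n; apply/eqP; rewrite -subr_eq0; apply/eqP.
by have := decompB hf hg; rewrite subrr => /decomp_eq0/(_ n).
Qed.

Lemma decompD u v f g :
  decomp u f -> decomp v g -> decomp (u + v) (fun n => f n + g n).
Proof.
move=> hf hg; have := decompB hf (decompB decomp0 hg).
rewrite sub0r opprK => -[h1 [s [us h0 hs]]]; split=> [n|].
  by have := h1 n; rewrite sub0r opprK.
exists s; split=> // [n /h0|]; first by rewrite sub0r opprK.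
by rewrite {1}hs; apply: eq_bigr => n _; rewrite sub0r opprK.
Qed.

End Decomposition.

Lemma decomp_map (V W : zmodType) (C : int -> set V) (D : int -> set W)
    (phi : V -> W) (m : int) v f :
  {morph phi : x y / x + y} ->
  (forall n u, C n u -> D (m + n) (phi u)) -> decomp C v f ->
  decomp D (phi v) (fun n => phi (f (n - m))).
Proof.
move=> phiD h [hf [s [us f0 ->]]].
have phi0 : phi 0 = 0.
  by apply/(addrI (phi 0)); rewrite -phiD !addr0.
split=> [n|]; first by have := h _ _ (hf (n - m)); rewrite addrC subrK.
exists [seq m + i | i <- s]; split.
- by rewrite map_inj_uniq //; apply: addrI.
- move=> n hn; rewrite f0 ?phi0 //; apply: contra hn => hn.
  by apply/mapP; exists (n - m) => //; rewrite addrC subrK.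
- rewrite (big_morph phi phiD phi0) big_map.
  by apply: eq_bigr => i _; rewrite addrAC subrr add0r.
Qed.

Lemma direct_sum_shift (V : zmodType) (C : int -> set V) (m : int) :
  direct_sum C -> direct_sum (fun n => C (n - m)).
Proof.
move=> hC; have [s0 sB sE sI] := hC; split=> [n|n u v|v|s c us hc h0 n ns].
- exact: s0.
- exact: sB.
- have [s [c [hc ->]]] := sE v.
  exists [seq m + i | i <- s], (fun i => c (i - m)); split=> //.
  by rewrite big_map; apply: eq_bigr => i _; rewrite addrAC subrr add0r.
- have := sI [seq i - m | i <- s] (fun i => c (i + m)).
  rewrite map_inj_uniq; last exact: addIr.
  have hc' i : C i (c (i + m)) by have := hc (i + m); rewrite addrK.
  have hs : \sum_(i <- [seq i - m | i <- s]) c (i + m) = 0.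
    by rewrite big_map -[RHS]h0; apply: eq_bigr => i _; rewrite subrK.
  move=> /(_ us hc' hs (n - m)); rewrite subrK; apply.
  by apply/mapP; exists n.
Qed.

(** * Graded modules *)

Section GradedModules.
Variable A : graded_ring.
Implicit Types (V : graded_module A).

Definition gr_int_comp (n : int) : set A := int_comp (gr_comp A) n.

Lemma gr_int_comp0 n : gr_int_comp n 0.
Proof. by have [h _ _ _] := gr_sum A; apply: h. Qed.
Lemma gr_int_compB n u v : gr_int_comp n u -> gr_int_comp n v ->
  gr_int_comp n (u - v).
Proof. by have [_ h _ _] := gr_sum A; apply: h. Qed.
Lemma gr_int_compD n u v : gr_int_comp n u -> gr_int_comp n v ->
  gr_int_comp n (u + v).
Proof.
by move=> hu hv; rewrite -[v]opprK -[- v]add0r;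
  apply/gr_int_compB/gr_int_compB/hv/gr_int_comp0.
Qed.
Lemma gr_int_compN n u : gr_int_comp n u -> gr_int_comp n (- u).
Proof. by rewrite -[- u]add0r; apply/gr_int_compB/gr_int_comp0. Qed.

Lemma gm_comp0 V n : gm_comp V n 0. Proof. by have [h _ _ _] := gm_sum V. Qed.
Lemma gm_compB V n u v : gm_comp V n u -> gm_comp V n v -> gm_comp V n (u - v).
Proof. by have [_ h _ _] := gm_sum V; apply: h. Qed.
Lemma gm_compN V n u : gm_comp V n u -> gm_comp V n (- u).
Proof. by rewrite -[- u]add0r; apply/gm_compB/gm_comp0. Qed.
Lemma gm_compD V n u v : gm_comp V n u -> gm_comp V n v -> gm_comp V n (u + v).
Proof. by move=> hu hv; rewrite -[v]opprK; apply/gm_compB/gm_compN. Qed.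

Lemma gr_int_comp_act V m n a v :
  gr_int_comp m a -> gm_comp V n v -> gm_comp V (m + n) (a *: v).
Proof.
case: m => m /= ha hv; first exact: gm_act.
by rewrite ha scale0r; apply: gm_comp0.
Qed.

Lemma gr_int_compM m n a b : gr_int_comp m a -> gr_int_comp n b ->
  gr_int_comp (m + n) (a * b).
Proof. exact: (@gr_int_comp_act (regular_module A)). Qed.

Lemma gr_int_comp1 : gr_int_comp 0 1. Proof. exact: (gr_one A). Qed.

Lemma gr_int_compX m a t : gr_int_comp m a -> gr_int_comp (m * t%:Z) (a ^+ t).
Proof.
move=> ha; elim: t => [|t IH]; first by rewrite mulr0; apply: gr_int_comp1.
by rewrite exprS -addn1 PoszD mulrDr mulr1 addrC; apply: gr_int_compM.
Qed.

(** Exactness is stated for arbitrary elements; this makes the preimages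
homogeneous, as every step of a diagram chase in a fixed degree requires. *)
Lemma graded_lift (U V : graded_module A) (f : {linear U -> V}) n u v :
  graded_hom f -> f u = v -> gm_comp V n v ->
  exists2 u', gm_comp U n u' & f u' = v.
Proof.
move=> hf fu hv; have [c hc] := decomp_exists (gm_sum U) u.
have h1 : decomp (gm_comp V) (f u) (fun i => f (c (i - 0))).
  apply: decomp_map hc => [x y|i w]; first exact: raddfD.
    by rewrite add0r; apply: hf.
have h2 := decomp_single (gm_sum V) hv.
exists (c n); first by case: hc.
by rewrite fu in h1; have := decomp_uniq (gm_sum V) h1 h2 n; rewrite subr0 eqxx.
Qed.

End GradedModules.

(** * Lifting to graded injective modules *)

Section PairIdeal.
Variables (A : graded_ring) (m : int) (g1 g2 : A).

Definition pair_pred : {pred A^o} :=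
  fun u => `[< exists p q : A, u = p * g1 + q * g2 >].

Lemma pair_predP (u : A^o) :
  reflect (exists p q : A, u = p * g1 + q * g2) (u \in pair_pred).
Proof. exact: asboolP. Qed.

Lemma pair_submod_closed : submod_closed pair_pred.
Proof.
split; first by apply/pair_predP; exists 0, 0; rewrite !mul0r addr0.
move=> a u v /pair_predP[p [q ->]] /pair_predP[p' [q' ->]]; apply/pair_predP.
exists (a * p + p'), (a * q + q'); rewrite [a *: _]mulrDr !mulrDl !mulrA.
by rewrite addrACA.
Qed.

HB.instance Definition _ := GRing.isSubmodClosed.Build _ _ pair_pred
  pair_submod_closed.

Record pair_ideal := PairIdeal { pair_val : A^o; _ : pair_pred pair_val }.

HB.instance Definition _ := [isSub for pair_val].
HB.instance Definition _ := [Choice of pair_ideal by <:].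
HB.instance Definition _ :=
  [SubChoice_isSubLmodule of pair_ideal by <:].

End PairIdeal.

(** Bundles a function that was built by choice into a linear map. *)
Lemma linear_exists (R : nzRingType) (U V : lmodType R) (f : U -> V) :
  linear f -> exists g : {linear U -> V}, g =1 f.
Proof.
move=> hf; pose L := GRing.isLinear.Build R U V _ f hf.
by exists (HB.pack_for {linear U -> V} f L).
Qed.

(** The ideal (g1, g2) and the ring are both shifted by n, so that a degree 0
map from the shifted ring to E is the choice of an element of E_n, the image
of 1. *)
Section PairModule.
Variables (A : graded_ring) (m n : int) (g1 g2 : A).
Hypotheses (hg1 : gr_int_comp m g1) (hg2 : gr_int_comp m g2).

Local Notation P := (pair_ideal g1 g2).
Let C (j : int) : set P := [set u | gr_int_comp (j - n) (val u)].
Let CE j u : C j u = gr_int_comp (j - n) (val u). Proof. by []. Qed.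

Lemma shift_act (V : graded_module A) (i : nat) (j : int) (a : A) (v : V) :
  gr_comp A i a -> gm_comp V (j - n) v -> gm_comp V (i%:Z + j - n) (a *: v).
Proof. by move=> ha hv; rewrite -addrA; apply: gm_act. Qed.

Definition shift_module : graded_module A :=
  @GradedModule A A^o (fun j => gm_comp (regular_module A) (j - n))
    (@shift_act (regular_module A))
    (direct_sum_shift n (gm_sum (regular_module A))).

Lemma pair_combination (p q : A) : exists u : P, val u = p * g1 + q * g2.
Proof.
have h : pair_pred g1 g2 (p * g1 + q * g2) by apply/pair_predP; exists p, q.
by exists (PairIdeal h).
Qed.

Lemma decomp_pair (p q : A) cp cq :
  decomp (@gr_int_comp A) p cp -> decomp (@gr_int_comp A) q cq ->
  decomp (@gr_int_comp A) (p * g1 + q * g2)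
    (fun i => cp (i - m) * g1 + cq (i - m) * g2).
Proof.
move=> hp hq; apply: (decompD (gr_sum A)).
  apply: (decomp_map (phi := fun x => x * g1) (m := m) _ _ hp) => [x y|i u hu].
    exact: mulrDl.
  by rewrite addrC; apply: gr_int_compM.
apply: (decomp_map (phi := fun x => x * g2) (m := m) _ _ hq) => [x y|i u hu].
  exact: mulrDl.
by rewrite addrC; apply: gr_int_compM.
Qed.

Lemma pair_direct_sum : direct_sum C.
Proof.
have [s0 sB sE sI] := direct_sum_shift n (gr_sum A).
split=> [j|j u v|v|s c us hc h0 j js].
- by rewrite CE raddf0; apply: s0.
- by rewrite !CE raddfB; apply: sB.
- have /pair_predP[p [q vE]] : val v \in pair_pred g1 g2 by case: (v).
  have [cp hp] := decomp_exists (gr_sum A) p.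
  have [cq hq] := decomp_exists (gr_sum A) q.
  have [hd [s [us d0 vs]]] := decomp_pair hp hq.
  have /choice[c hc] : forall j, exists u : P,
      val u = cp (j - n - m) * g1 + cq (j - n - m) * g2.
    by move=> j; apply: pair_combination.
  exists [seq n + i | i <- s], c; split=> [j|]; first by rewrite CE hc.
  apply: val_inj; rewrite raddf_sum vE vs big_map; apply: eq_bigr => i _.
  by rewrite [RHS]hc [n + i]addrC addrK.
- apply: val_inj; rewrite raddf0; apply: (sI s (val \o c)) => //=.
  have := congr1 val h0; rewrite raddf_sum [RHS]raddf0 => hs.
  by rewrite -[RHS]hs; apply: eq_bigr.
Qed.

Lemma pair_act (i : nat) (j : int) a (u : P) :
  gr_comp A i a -> C j u -> C (i%:Z + j) (a *: u).
Proof.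
move=> ha; rewrite !CE linearZ; exact: (@shift_act (regular_module A)).
Qed.

Definition pair_module : graded_module A :=
  @GradedModule A P C pair_act pair_direct_sum.

(** Baer's criterion for an ideal with two generators of the same degree: the
equations g1 y = v1 and g2 y = v2 are solvable in E as soon as (v1, v2)
satisfies the homogeneous syzygies of (g1, g2), because then g_i |-> v_i
defines a map from the ideal to E that extends to the whole ring. *)
Lemma injective_lift (E : graded_module A) (hE : graded_injective E)
    (v1 v2 : E) :
  gm_comp E (m + n) v1 -> gm_comp E (m + n) v2 ->
  (forall i p q, gr_int_comp i p -> gr_int_comp i q -> p * g1 + q * g2 = 0 ->
     p *: v1 + q *: v2 = 0) ->
  exists y, [/\ gm_comp E n y, g1 *: y = v1 & g2 *: y = v2].
Proof.
move=> hv1 hv2 rel.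
have dec_v (p q : A) cp cq :
    decomp (@gr_int_comp A) p cp -> decomp (@gr_int_comp A) q cq ->
    decomp (gm_comp E) (p *: v1 + q *: v2)
      (fun i => cp (i - (m + n)) *: v1 + cq (i - (m + n)) *: v2).
  move=> hp hq; apply: (decompD (gm_sum E)).
    apply: (decomp_map (phi := fun x => x *: v1) (m := m + n) _ _ hp)
      => [x y|i u hu].
      exact: scalerDl.
    by rewrite addrC; apply: gr_int_comp_act.
  apply: (decomp_map (phi := fun x => x *: v2) (m := m + n) _ _ hq)
    => [x y|i u hu].
    exact: scalerDl.
  by rewrite addrC; apply: gr_int_comp_act.
have rel0 p q : p * g1 + q * g2 = 0 -> p *: v1 + q *: v2 = 0.
  move=> h0; have [cp hp] := decomp_exists (gr_sum A) p.
  have [cq hq] := decomp_exists (gr_sum A) q.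
  apply: decomp0P (dec_v _ _ _ _ hp hq) _ => j.
  apply: rel; [exact: hp.1 | exact: hq.1 |].
  have := decomp_pair hp hq; rewrite h0 => /(decomp_eq0 (gr_sum A)).
  by move=> /(_ (j - (m + n) + m)); rewrite addrK.
have rel1 p q p' q' : p * g1 + q * g2 = p' * g1 + q' * g2 ->
    p *: v1 + q *: v2 = p' *: v1 + q' *: v2.
  move=> /eqP; rewrite -subr_eq0 opprD addrACA -!mulrBl => /eqP/rel0/eqP.
  by rewrite !scalerBl addrACA -opprD subr_eq0 => /eqP.
have /choice[f hf] : forall u : P, exists w : E,
    forall p q, val u = p * g1 + q * g2 -> w = p *: v1 + q *: v2.
  move=> u; have /pair_predP[p [q uE]] : val u \in pair_pred g1 g2 by case: (u).
  by exists (p *: v1 + q *: v2) => p' q' uE'; apply: rel1; rewrite -uE.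
have fE u : exists p q, val u = p * g1 + q * g2 /\ f u = p *: v1 + q *: v2.
  have /pair_predP[p [q uE]] : val u \in pair_pred g1 g2 by case: (u).
  by exists p, q; split=> //; apply: hf.
have flin : linear f.
  move=> a u v; have [p [q [uE ->]]] := fE u; have [p' [q' [vE ->]]] := fE v.
  rewrite (hf (a *: u + v) (a * p + p') (a * q + q')).
    by rewrite scalerDr !scalerDl !scalerA addrACA.
  have -> : val (a *: u + v) = a *: val u + val v by exact: (linearP (val :
    {linear P -> A^o})).
  rewrite uE vE [a *: _]mulrDr !mulrDl !mulrA.
  by rewrite addrACA.
have [F FE] := linear_exists flin.
have Fgr : @graded_hom A pair_module E F.
  move=> j u hu; rewrite FE; have [p [q [uE fuE]]] := fE u.
  have [cp hp] := decomp_exists (gr_sum A) p.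
  have [cq hq] := decomp_exists (gr_sum A) q.
  have h1 := decomp_pair hp hq; rewrite -uE in h1.
  have h2 := decomp_uniq (gr_sum A) h1 (decomp_single (gr_sum A) hu).
  have -> : f u = cp (j - n - m) *: v1 + cq (j - n - m) *: v2.
    by apply: hf; have := h2 (j - n); rewrite eqxx => <-.
  have act w v : gr_int_comp (j - n - m) w -> gm_comp E (m + n) v ->
      gm_comp E j (w *: v).
    by move=> hw hv; have := gr_int_comp_act hw hv; rewrite addrA !subrK.
  by apply: gm_compD; apply: act => //; [exact: hp.1 | exact: hq.1].
pose i : {linear P -> A^o} := val.
have [||| G [Ggr GE]] := hE pair_module shift_module i F.
- by move=> j u.
- exact: val_inj.
- exact: Fgr.
exists (G (1 : A^o)); split.
- by apply: Ggr; rewrite /= subrr; apply: gr_int_comp1.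
- have [u uE] := pair_combination 1 0; rewrite mul1r mul0r addr0 in uE.
  rewrite -linearZ /= [X in G X]mulr1 -uE [LHS]GE FE (hf u 1 0).
    by rewrite scale1r scale0r addr0.
  by rewrite mul1r mul0r addr0.
- have [u uE] := pair_combination 0 1; rewrite mul1r mul0r add0r in uE.
  rewrite -linearZ /= [X in G X]mulr1 -uE [LHS]GE FE (hf u 0 1).
    by rewrite scale1r scale0r add0r.
  by rewrite mul1r mul0r add0r.
Qed.

End PairModule.

(** * Local cohomology with support in two elements *)

Lemma max_exists (S : set int) (N : int) : (forall n, S n -> n <= N) ->
  exists o, is_max S o.
Proof.
move=> hN; have [[n0 hn0]|S0] := pselect (exists n, S n); last first.
  by exists None; rewrite /is_max -subset0 => n hn; apply: S0; exists n.
suff [m Sm mP] : exists2 m, S m & forall n, S n -> n <= m by exists (Some m).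
move: {2}`|N - n0|%N (leqnn `|N - n0|%N) => k.
elim: k n0 hn0 => [|k IH] n0 hn0 hk.
  by exists n0 => // n /hN; have := hN _ hn0; lia.
have [[n [hn nn0]]|h] := pselect (exists n, S n /\ n0 < n).
  by apply: (IH n hn); have := hN _ hn; lia.
exists n0 => // n hn; rewrite leNgt; apply/negP => nn0.
by apply: h; exists n.
Qed.

Section TwoElements.
Variable A : graded_ring.

(** The submodule that is usually written Gamma_(c) (V). *)
Definition powtorsion (V : lmodType A) (c : A) : set V :=
  [set v | exists t : nat, c ^+ t *: v = 0].

(** Only homogeneous elements are tested: this is all that degreewise
arguments use, and it is easy to verify in a ring that is known degree by
degree. *)
Definition hom_regular (c : A) : Prop :=
  forall n u, gr_int_comp n u -> c * u = 0 -> u = 0.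

Lemma powtorsion_leq (V : lmodType A) (c : A) (v : V) s t :
  (s <= t)%N -> c ^+ s *: v = 0 -> c ^+ t *: v = 0.
Proof. by move=> /subnK <- h; rewrite exprD -scalerA h scaler0. Qed.

Lemma powtorsionB (V : lmodType A) (c : A) (u v : V) :
  powtorsion c u -> powtorsion c v -> powtorsion c (u - v).
Proof.
move=> [s hs] [t ht]; exists (s + t)%N.
by rewrite scalerBr (powtorsion_leq (leq_addr _ _) hs) (powtorsion_leq
  (leq_addl _ _) ht) subrr.
Qed.

Lemma powtorsion0 (V : lmodType A) (c : A) : powtorsion c (0 : V).
Proof. by exists 0%N; rewrite scaler0. Qed.

Lemma powtorsionD (V : lmodType A) (c : A) (u v : V) :
  powtorsion c u -> powtorsion c v -> powtorsion c (u + v).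
Proof.
by move=> hu hv; rewrite -[v]opprK -[- v]add0r;
  apply/powtorsionB/powtorsionB/hv/powtorsion0.
Qed.

Lemma powtorsion_linear (U V : lmodType A) (f : {linear U -> V}) c u :
  powtorsion c u -> powtorsion c (f u).
Proof. by move=> [t ht]; exists t; rewrite -linearZ ht linear0. Qed.

Lemma powtorsion_mull (V : lmodType A) (a c : A) (v : V) :
  powtorsion c v -> powtorsion (a * c) v.
Proof. by move=> [t ht]; exists t; rewrite exprMn -scalerA ht scaler0. Qed.

Lemma hom_regularX c e t :
  gr_int_comp e c -> hom_regular c -> hom_regular (c ^+ t).
Proof.
move=> hc rc; elim: t => [|t IH] n u hu; first by rewrite expr0 mul1r.
rewrite exprSr -mulrA => /(IH (e + n)) h; apply: (rc _ _ hu); apply: h.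
exact: gr_int_compM.
Qed.

Lemma hom_regularM c c' e :
  gr_int_comp e c' -> hom_regular c -> hom_regular c' -> hom_regular (c * c').
Proof.
move=> hc rc rc' n u hu; rewrite -mulrA => /(rc (e + n)) h.
by apply: (rc' _ _ hu); apply: h; apply: gr_int_compM.
Qed.

Lemma hom_regularI c n u v :
  hom_regular c -> gr_int_comp n u -> gr_int_comp n v -> c * u = c * v -> u = v.
Proof.
move=> rc hu hv /eqP; rewrite -subr_eq0 -mulrBr => /eqP/rc h.
by apply/eqP; rewrite -subr_eq0; apply/eqP/h/gr_int_compB/hv.
Qed.

Lemma gr_int_comp_eq m n (v : A) : gr_int_comp m v -> m = n -> gr_int_comp n v.
Proof. by move=> h <-. Qed.

(** Take both generators of the ideal in [injective_lift] to be c: the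
syzygies of (c, c) are the (p, -p) when c is regular. *)
Lemma injective_divisible (E : graded_module A) (hE : graded_injective E)
    c e n v : gr_int_comp e c -> hom_regular c -> gm_comp E (e + n) v ->
  exists2 y, gm_comp E n y & c *: y = v.
Proof.
move=> hc rc hv; have [|y [hy cy _]] := injective_lift hc hc hE hv hv.
  move=> i p q hp hq; rewrite -mulrDl -scalerDl mulrC.
  by move=> /(rc i) ->; [rewrite scale0r | apply: gr_int_compD].
by exists y.
Qed.

(** The conditions under which A_+ and (a, b) have the same torsion [cp_red]
and the sequence of a and b is weakly proregular [cp_sat]. The fraction u /
b^r = v / a^r of [cp_sat] has degree n. *)
Record cech_pair (a b : A) : Prop := CechPair {
  cp_a : gr_int_comp 1 a;
  cp_b : gr_int_comp 1 b;
  cp_rega : hom_regular a;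
  cp_regb : hom_regular b;
  cp_red : exists N : nat, forall n u, (N <= n)%N -> gr_comp A n.+1 u ->
    exists u1 u2, [/\ gr_comp A n u1, gr_comp A n u2 & u = a * u1 + b * u2];
  cp_sat : exists N : nat, forall n r u v, (N <= n)%N ->
    gr_comp A (n + r)%N u -> gr_comp A (n + r)%N v -> a ^+ r * u = b ^+ r * v ->
    exists2 w, gr_comp A n w & u = b ^+ r * w }.

(** The first cohomology of A -> A_a + A_b -> A_ab in degree n is nonzero:
the class is the fraction u / b^r = v / a^r, which does not lie in A. *)
Definition cech1 (a b : A) (n : int) : Prop :=
  exists (r : nat) u v, [/\ gr_int_comp (n + r%:Z) u, gr_int_comp (n + r%:Z) v,
    a ^+ r * u = b ^+ r * v & ~ exists2 w, gr_int_comp n w & u = b ^+ r * w].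

(** The fraction u / (a b)^t of A_ab is the sum of q / a^(t+s) and p /
b^(t+s). *)
Definition cech2_trivial (a b : A) (n : int) (t : nat) (u : A) : Prop :=
  exists (s : nat) p q, [/\ gr_int_comp (n + t%:Z + s%:Z) p,
    gr_int_comp (n + t%:Z + s%:Z) q &
    (a * b) ^+ s * u = a ^+ (t + s) * p + b ^+ (t + s) * q].

Definition cech2 (a b : A) (n : int) : Prop :=
  exists (t : nat) u,
    gr_int_comp (n + t%:Z + t%:Z) u /\ ~ cech2_trivial a b n t u.

Section CechPairs.
Variables (a b : A).
Hypothesis hab : cech_pair a b.

Let ha : gr_int_comp 1 a := cp_a hab.
Let hb : gr_int_comp 1 b := cp_b hab.
Let ra : hom_regular a := cp_rega hab.
Let rb : hom_regular b := cp_regb hab.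

Let haX t : gr_int_comp t%:Z (a ^+ t).
Proof. by have := gr_int_compX t ha; rewrite mul1r. Qed.
Let hbX t : gr_int_comp t%:Z (b ^+ t).
Proof. by have := gr_int_compX t hb; rewrite mul1r. Qed.
Let raX t : hom_regular (a ^+ t) := hom_regularX ha ra.
Let rbX t : hom_regular (b ^+ t) := hom_regularX hb rb.

(** Iterating the reduction, a monomial of degree e + f in a and b has a
factor a^e or b^f. *)
Lemma reduction_powers : exists N : nat, forall e f u,
  gr_comp A (N + (e + f))%N u -> exists p q, u = a ^+ e * p + b ^+ f * q.
Proof.
have [N hN] := cp_red hab; exists N => e f.
move: {2}(e + f)%N (erefl (e + f)%N) => s; elim: s e f => [|s IH] e f.
  move=> /eqP; rewrite addn_eq0 => /andP[/eqP-> _] u _.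
  by exists u, 0; rewrite mulr0 addr0 expr0 mul1r.
case: e => [|e]; first by move=> _ u _; exists u, 0; rewrite mulr0 addr0 mul1r.
case: f => [|f]; first by move=> _ u _; exists 0, u; rewrite mulr0 add0r mul1r.
move=> es u; rewrite es addnS.
move=> /(hN _ _ (leq_addr _ _)) [u1 [u2 [hu1 hu2 ->]]].
have [||p [q ->]] := IH e f.+1 _ u1;
  [lia|by have -> : (e + f.+1 = s)%N by lia|].
have [||p' [q' ->]] := IH e.+1 f _ u2;
  [lia|by have -> : (e.+1 + f = s)%N by lia|].
exists (p + b * p'), (a * q + q').
by rewrite !exprS; ring.
Qed.

Lemma irrelevant_pow T (c : A) : ideal_pow (@irrelevant_ideal A) T c ->
  ideal_gen [set u | exists2 n, (T <= n)%N & gr_comp A n u] c.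
Proof.
elim: T c => [|T IH] c; last first.
  move=> [s [hs ->]]; rewrite big_seq; apply: ideal_gen_sum => x /hs.
  move=> [u [v [[s1 [hs1 ->]] /IH [s2 [hs2 ->]] ->]]].
  rewrite mulr_suml mulr_sumr big_seq; apply: ideal_gen_sum => y /hs1[i i0 hi].
  rewrite mulr_sumr mulr_sumr big_seq; apply: ideal_gen_sum => z /hs2[j Tj hj].
  have -> : x.1 * (y.1 * y.2 * (z.1 * z.2)) = (x.1 * y.1 * z.1) * (y.2 * z.2).
    by ring.
  apply: ideal_genM; apply: ideal_gen_mem; exists (i + j)%N; first lia.
  exact: gr_mul.
move=> _; have [f [hf [s [us f0 ->]]]] := decomp_exists (gr_sum A) c.
apply: ideal_gen_sum => i _; case: i (hf i) => i /= hi.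
  by apply: ideal_gen_mem; exists i.
by rewrite hi; apply: ideal_gen0.
Qed.

(** The powers of A_+ and of (a, b) are cofinal by [reduction_powers]. *)
Lemma torsionP (V : graded_module A) (v : V) :
  torsion v <-> powtorsion a v /\ powtorsion b v.
Proof.
have powI c t : gr_comp A 1%N c -> ideal_pow (@irrelevant_ideal A) t (c ^+ t).
  move=> hc; elim: t => [//|t IH]; rewrite exprS; apply: ideal_mul_mem => //.
  by apply: ideal_gen_mem; exists 1%N.
split=> [[t ht]|[[s hs] [t ht]]].
  by split; exists t; apply/ht/powI.
have [N hN] := reduction_powers; exists (N + (s + t))%N => c /irrelevant_pow.
move=> [r [hr ->]]; rewrite scaler_suml big_seq big1 // => x /hr[n Nn hn].
have nE : n = (N + ((s + (n - (N + (s + t)))) + t))%N by lia.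
rewrite nE in hn; have [p [q ->]] := hN _ _ _ hn.
rewrite -scalerA scalerDl [a ^+ _ * p]mulrC [b ^+ _ * q]mulrC -!scalerA ht.
by rewrite (powtorsion_leq (leq_addr _ _) hs) !scaler0 addr0 scaler0.
Qed.

(** Surjectivity in the Mayer-Vietoris sequence: E is injective, so the part
y of x is found by prescribing a^s y = 0 and b^s y = b^s x. A syzygy p a^s +
q b^s = 0 gives the fraction q / a^s = - p / b^s of degree at least -s, and
for large s its product with (a b)^(s-t) lies in A by [cp_sat]; so q b^s is a
multiple of (a b)^t, which kills x. *)
Lemma injective_split (E : graded_module A) (hE : graded_injective E)
    n (x : E) :
  gm_comp E n x -> powtorsion (a * b) x ->
  exists y, [/\ gm_comp E n y, powtorsion a y & powtorsion b (x - y)].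
Proof.
move=> hx [t ht]; have [N hN] := cp_sat hab.
(* With this s, the degree i + s - 2t of the fraction w below is at least N. *)
pose s := (N + t + t)%N.
have [|||y [hy ay bY]] := injective_lift (haX s) (hbX s) hE
    (v1 := 0) (v2 := b ^+ s *: x) (n := n).
- exact: gm_comp0.
- by apply: gr_int_comp_act.
- case=> i p q hp hq; last by rewrite hp hq !scale0r addr0.
  move=> /eqP; rewrite addr_eq0 => /eqP pq.
  rewrite scaler0 add0r scalerA.
  have hpa : gr_int_comp (N + i + t)%:Z (- p * a ^+ (N + t)).
    apply: (@gr_int_comp_eq (i%:Z + (N + t)%:Z)); last lia.
    by apply: gr_int_compM => //; apply: gr_int_compN.
  have hqb : gr_int_comp (N + i + t)%:Z (q * b ^+ (N + t)).
    by apply: (@gr_int_comp_eq (i%:Z + (N + t)%:Z));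
      [exact: gr_int_compM | lia].
  have pqE : a ^+ t * (- p * a ^+ (N + t)) = b ^+ t * (q * b ^+ (N + t)).
    have := pq; rewrite /s !exprD => {}pq.
    have -> : a ^+ t * (- p * (a ^+ N * a ^+ t)) =
              - (p * (a ^+ N * a ^+ t * a ^+ t)) by ring.
    by rewrite pq; ring.
  have [w hw pw] := hN _ _ _ _ (leq_addr _ _) hpa hqb pqE.
  have qw : q * b ^+ (N + t) = a ^+ t * w.
    apply: (@hom_regularI (b ^+ t) (N + i + t)%:Z) => //.
      by apply: (@gr_int_comp_eq (t%:Z + (N + i)%:Z));
        [exact: gr_int_compM | lia].
    by rewrite -pqE pw; ring.
  by rewrite /s exprD mulrA qw mulrAC -exprMn mulrC -scalerA ht scaler0.
exists y; split=> //; first by exists s.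
by exists s; rewrite scalerBr bY subrr.
Qed.

Section LocalCohomologyOfPair.
Variable E : injective_resolution (regular_module A).
Local Notation eps := (ir_aug E).
Local Notation d := (ir_diff E).

Let rab : hom_regular (a * b) := hom_regularM hb ra rb.
Let hm : gr_int_comp 2 (a * b). Proof. by have := gr_int_compM ha hb. Qed.
Let hmX t : gr_int_comp (t%:Z + t%:Z) ((a * b) ^+ t).
Proof. by apply: gr_int_comp_eq (gr_int_compX t hm) _; lia. Qed.
Let rabX t : hom_regular ((a * b) ^+ t) := hom_regularX hm rab.

Let epsM (c u : A) : eps (c * u) = c *: eps u.
Proof. by rewrite -(linearZZ eps c u). Qed.

Let eps_inj0 (u : A) : eps u = 0 -> u = 0.
Proof. by move=> h; apply: (@ir_aug_inj _ _ E); rewrite h raddf0. Qed.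

Let eps_hom n (u : A) : gr_int_comp n u -> gm_comp (E 0%N) n (eps u).
Proof. exact: (@ir_aug_hom _ _ E). Qed.

Let d_hom i n (v : E i) : gm_comp (E i) n v -> gm_comp (E i.+1) n (d i v).
Proof. exact: (@ir_diff_hom _ _ E i). Qed.

Let d_eps (u : A) : d 0%N (eps u) = 0.
Proof. by apply/ir_exact0; exists u. Qed.

Let d_d i (v : E i) : d i.+1 (d i v) = 0.
Proof. by apply/ir_exactS; exists v. Qed.

Let exact0 n (v : E 0%N) : gm_comp (E 0%N) n v -> d 0%N v = 0 ->
  exists2 u : A, gr_int_comp n u & eps u = v.
Proof.
by move=> hv /ir_exact0 [u uv]; exact: (graded_lift (@ir_aug_hom _ _ E) uv hv).
Qed.

Let exactS i n (v : E i.+1) : gm_comp (E i.+1) n v -> d i.+1 v = 0 ->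
  exists2 u : E i, gm_comp (E i) n u & d i u = v.
Proof.
by move=> hv /ir_exactS [u uv];
  exact: (graded_lift (@ir_diff_hom _ _ E i) uv hv).
Qed.

Let divisible i c e n (v : E i) : gr_int_comp e c -> hom_regular c ->
  gm_comp (E i) (e + n) v -> exists2 y, gm_comp (E i) n y & c *: y = v.
Proof. exact: (injective_divisible (@ir_inj _ _ E i)). Qed.

Let split_ab i n (x : E i) : gm_comp (E i) n x -> powtorsion (a * b) x ->
  exists y, [/\ gm_comp (E i) n y, powtorsion a y & powtorsion b (x - y)].
Proof. exact: (injective_split (@ir_inj _ _ E i)). Qed.

(** H^1 with support in c is A_c / A: the cocycle x corresponds to the
fraction u / c^t. *)
Lemma powtorsion_cocycle1 c e n (x : E 1%N) : gr_int_comp e c ->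
  gm_comp (E 1%N) n x -> powtorsion c x -> d 1%N x = 0 ->
  exists (y : E 0%N) t u, [/\ gm_comp (E 0%N) n y, d 0%N y = x,
    gr_int_comp (e * t%:Z + n) u & c ^+ t *: y = eps u].
Proof.
move=> hc hx [t ht] /(exactS hx) [y hy dy]; exists y, t.
have hcy : gm_comp (E 0%N) (e * t%:Z + n) (c ^+ t *: y).
  by apply: gr_int_comp_act hy; apply: gr_int_compX.
have [|u hu uE] := exact0 hcy; first by rewrite linearZ /= dy.
by exists u.
Qed.

(** H^i with support in c vanishes for i > 1, as divisibility by c makes E ->
E_c surjective. *)
Lemma powtorsion_cocycleS c e i n (x : E i.+2) : gr_int_comp e c ->
  hom_regular c ->
  gm_comp (E i.+2) n x -> powtorsion c x -> d i.+2 x = 0 ->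
  exists y : E i.+1, [/\ gm_comp (E i.+1) n y, powtorsion c y & d i.+1 y = x].
Proof.
move=> hc rc hx [t ht] /(exactS hx) [y hy dy].
have hcy : gm_comp (E i.+1) (e * t%:Z + n) (c ^+ t *: y).
  by apply: gr_int_comp_act hy; apply: gr_int_compX.
have [|z hz zE] := exactS hcy; first by rewrite linearZ /= dy.
have [z' hz' z'E] := divisible (gr_int_compX t hc) (hom_regularX hc rc) hz.
exists (y - d i z'); split.
- by apply: gm_compB => //; apply: d_hom.
- by exists t; rewrite scalerBr -linearZ z'E zE subrr.
- by rewrite linearB /= d_d subr0.
Qed.

Lemma lc0_vanishes n : ~ lc_neq0 E 0%N n.
Proof.
move=> [v [/torsionP[[t ht] _] hv dv]]; apply.
have [u hu uE] := exact0 hv dv; rewrite -uE.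
have -> : u = 0.
  by apply: (@raX t _ _ hu); apply: eps_inj0; rewrite epsM uE.
by rewrite /coboundary /= raddf0.
Qed.

(** A cocycle x of degree 1 is d y for some y in E 0; since x is torsion, a^r
y and b^r y come from A, which gives the two fractions. Changing y by an
element of A is what makes x the boundary of a torsion element. *)
Lemma lc1_cech n : lc_neq0 E 1%N n <-> cech1 a b n.
Proof.
split=> [[x [/torsionP[[t at0] [s bs0]] hx dx ncob]]|].
- have [y hy dy] := exactS hx dx; pose r := (s + t)%N.
  have lift c : gr_int_comp 1 c -> c ^+ r *: x = 0 ->
      exists2 u : A, gr_int_comp (n + r%:Z) u & eps u = c ^+ r *: y.
    move=> hc h; apply: exact0; last by rewrite linearZ /= dy.
    rewrite addrC; apply: gr_int_comp_act hy.
    by have := gr_int_compX r hc; rewrite mul1r.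
  have [v hv vE] := lift a ha (powtorsion_leq (leq_addl _ _) at0).
  have [u hu uE] := lift b hb (powtorsion_leq (leq_addr _ _) bs0).
  exists r, u, v; split=> //.
    by apply: (@ir_aug_inj _ _ E); rewrite !epsM uE vE !scalerA mulrC.
  move=> [w hw wE]; apply: ncob; exists (y - eps w); split.
  + have vw : v = a ^+ r * w.
      apply: (@hom_regularI (b ^+ r) (n + r%:Z)) => //.
        by rewrite addrC; apply: gr_int_compM.
      by rewrite mulrCA -wE; apply: (@ir_aug_inj _ _ E);
        rewrite !epsM uE vE !scalerA mulrC.
    apply/torsionP; split; exists r; rewrite scalerBr -epsM.
      by rewrite -vE vw subrr.
    by rewrite -uE wE subrr.
  + by apply: gm_compB => //; apply: eps_hom.
  + by rewrite linearB /= d_eps subr0.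
- move=> [r [u [v [hu hv uv nw]]]].
  have [y1 hy1 y1E] : exists2 y, gm_comp (E 0%N) n y & b ^+ r *: y = eps u.
    by apply: divisible (hbX r) _ _ => //; rewrite addrC; apply: eps_hom.
  have [y2 hy2 y2E] : exists2 y, gm_comp (E 0%N) n y & a ^+ r *: y = eps v.
    by apply: divisible (haX r) _ _ => //; rewrite addrC; apply: eps_hom.
  have [||z [hz az bz]] := split_ab (n := n) (x := y1 - y2).
  + exact: gm_compB.
  + exists r; rewrite exprMn scalerBr -scalerA y1E [_ * _]mulrC -scalerA y2E.
    by rewrite -!epsM uv subrr.
  pose y := y2 + z.
  have yE : y = y1 - (y1 - y2 - z) by rewrite -[y1 - y2 - z]addrA -opprD subKr.
  have hy : gm_comp (E 0%N) n y by apply: gm_compD.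
  exists (d 0%N y); split.
  + apply/torsionP; split.
      rewrite linearD; apply: powtorsionD; last exact: powtorsion_linear.
      by exists r; rewrite -linearZ /= y2E d_eps.
    rewrite yE linearB; apply: powtorsionB; last exact: powtorsion_linear.
    by exists r; rewrite -linearZ /= y1E d_eps.
  + exact: d_hom.
  + exact: d_d.
  move=> [y' [/torsionP[_ [s bs]] hy' dy']]; apply: nw.
  have [||w hw wE] := exact0 (n := n) (v := y - y').
  + exact: gm_compB.
  + by rewrite linearB /= dy' subrr.
  exists w => //; have [t bt] := bz; pose q := (s + t)%N.
  have h : b ^+ q *: y1 = b ^+ q *: eps w.
    have bz' : b ^+ q *: (y1 - y2 - z) = 0 := powtorsion_leq (leq_addl _ _) bt.
    rewrite wE yE scalerBr (powtorsion_leq (leq_addr _ _) bs) subr0.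
    by rewrite [RHS]scalerBr bz' subr0.
  apply: (@hom_regularI (b ^+ q) (n + r%:Z)) => //.
    by rewrite addrC; apply: gr_int_compM.
  apply: (@ir_aug_inj _ _ E).
  by rewrite mulrCA !epsM -y1E -h !scalerA mulrC.
Qed.

(** The connecting map from H^1 with support in a b to H^2: x bounds y1,
which is a-torsion, and y2, which is b-torsion, and y1 - y2 = d y represents
the fraction u / (a b)^t. Then x bounds a torsion element iff this fraction
comes from A_a + A_b. *)
Lemma connecting_coboundary n (x : E 2%N) (y1 y2 : E 1%N) (y : E 0%N)
    t (u : A) :
  gm_comp (E 1%N) n y1 -> gm_comp (E 1%N) n y2 -> gm_comp (E 0%N) n y ->
  powtorsion a y1 -> powtorsion b y2 -> d 1%N y1 = x -> d 1%N y2 = x ->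
  y1 - y2 = d 0%N y -> gr_int_comp (n + t%:Z + t%:Z) u ->
  (a * b) ^+ t *: y = eps u ->
  coboundary n x <-> cech2_trivial a b n t u.
Proof.
move=> hy1 hy2 hy ay1 by2 dy1 dy2 y12 hu yu; split.
- move=> [y0 [/torsionP[ay0 by0] hy0 dy0]].
  have [|||z1 [r [p [hz1 dz1 hp pE]]]] :=
    @powtorsion_cocycle1 a 1 n (y1 - y0) ha.
  + exact: gm_compB.
  + exact: powtorsionB.
  + by rewrite linearB /= dy1 dy0 subrr.
  have [|||z2 [s [q [hz2 dz2 hq qE]]]] :=
    @powtorsion_cocycle1 b 1 n (y0 - y2) hb.
  + exact: gm_compB.
  + exact: powtorsionB.
  + by rewrite linearB /= dy2 dy0 subrr.
  have [||w hw wE] := exact0 (n := n) (v := y - z1 - z2).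
  + by do 2?apply: gm_compB.
  + rewrite !linearB /= dz1 dz2 -y12.
    have -> : y1 - y2 = (y1 - y0) + (y0 - y2) by rewrite addrA subrK.
    by rewrite -addrA -opprD subrr.
  pose m := (r + s)%N.
  (* Multiply y = z1 + z2 + eps w by (a b)^(t + m), with w in A put on the
  side of b. *)
  exists m, (b ^+ (t + r) * q), (a ^+ (t + s) * p + a ^+ (t + m) * w); split.
  + by apply: (@gr_int_comp_eq ((t + r)%:Z + (1 * s%:Z + n)));
    [apply: gr_int_compM | lia].
  + apply: gr_int_compD.
      by apply: (@gr_int_comp_eq ((t + s)%:Z + (1 * r%:Z + n)));
        [apply: gr_int_compM | lia].
    by apply: (@gr_int_comp_eq ((t + m)%:Z + n)); [apply: gr_int_compM | lia].
  + apply: (@ir_aug_inj _ _ E); rewrite raddfD /= mulrDr raddfD /= !epsM.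
    rewrite -pE -qE -yu wE !scalerA.
    have e1 : a ^+ (t + m) * b ^+ (t + r) * b ^+ s = (a * b) ^+ (t + m).
      by rewrite -mulrA -exprD -addnA -exprMn.
    have e2 : b ^+ (t + m) * a ^+ (t + s) * a ^+ r = (a * b) ^+ (t + m).
      by rewrite -mulrA -exprD -addnA [(s + r)%N]addnC mulrC -exprMn.
    have e3 : b ^+ (t + m) * a ^+ (t + m) = (a * b) ^+ (t + m).
      by rewrite mulrC -exprMn.
    rewrite e1 e2 e3 -exprD [(m + t)%N]addnC -!scalerDr; congr (_ *: _).
    by rewrite addrA -[y - z1 - z2]addrA -opprD [z2 + z1]addrC addrC subrK.
- move=> [s [p [q [hp hq uE]]]].
  have [z1 hz1 z1E] : exists2 z, gm_comp (E 0%N) n z &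
      a ^+ (t + s) *: z = eps q.
    apply: divisible (haX (t + s)) _ _ => //; apply: eps_hom.
    by apply: gr_int_comp_eq hq _; lia.
  have [z2 hz2 z2E] : exists2 z, gm_comp (E 0%N) n z &
      b ^+ (t + s) *: z = eps p.
    apply: divisible (hbX (t + s)) _ _ => //; apply: eps_hom.
    by apply: gr_int_comp_eq hp _; lia.
  have [||g [hg ag bg]] := split_ab (n := n) (x := y - z1 - z2).
  + by do 2?apply: gm_compB.
  + exists (t + s)%N; rewrite !scalerBr.
    have -> : (a * b) ^+ (t + s) *: y = eps ((a * b) ^+ s * u).
      by rewrite epsM -yu scalerA -exprD addnC.
    have -> : (a * b) ^+ (t + s) *: z1 = eps (b ^+ (t + s) * q).
      by rewrite epsM -z1E scalerA exprMn mulrC.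
    have -> : (a * b) ^+ (t + s) *: z2 = eps (a ^+ (t + s) * p).
      by rewrite epsM -z2E scalerA exprMn.
    by rewrite uE raddfD /= addrK subrr.
  pose g' := y - z1 - z2 - g.
  have y0E : y1 - d 0%N (z1 + g) = y2 + d 0%N (z2 + g').
    apply/eqP; rewrite subr_eq -addrA -linearD /=.
    have -> : z2 + g' + (z1 + g) = y.
      by rewrite addrACA subrK -[y - z1 - z2]addrA -opprD [z2 + z1]addrC addrC
        subrK.
    by rewrite -y12 addrC subrK.
  have hz1g : gm_comp (E 0%N) n (z1 + g) by apply: gm_compD.
  exists (y1 - d 0%N (z1 + g)); split.
  + apply/torsionP; split.
      apply: powtorsionB => //; rewrite linearD; apply: powtorsionD;
        last exact: powtorsion_linear.
      by exists (t + s)%N; rewrite -linearZ /= z1E d_eps.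
    rewrite y0E; apply: powtorsionD => //; rewrite linearD; apply: powtorsionD;
      last exact: powtorsion_linear.
    by exists (t + s)%N; rewrite -linearZ /= z2E d_eps.
  + by apply: gm_compB => //; apply: d_hom.
  + by rewrite linearB /= d_d subr0.
Qed.

Lemma lc2_cech n : lc_neq0 E 2%N n <-> cech2 a b n.
Proof.
split=> [[x [/torsionP[ax bx] hx dx ncob]]|[t [u [hu nu]]]].
- have [y1 [hy1 ay1 dy1]] := powtorsion_cocycleS ha ra hx ax dx.
  have [y2 [hy2 by2 dy2]] := powtorsion_cocycleS hb rb hx bx dx.
  have [|||y [t [u [hy dy hu yu]]]] :=
    @powtorsion_cocycle1 (a * b) 2 n (y1 - y2) hm.
  + exact: gm_compB.
  + by apply: powtorsionB; [rewrite mulrC;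
    apply: powtorsion_mull | apply: powtorsion_mull].
  + by rewrite linearB /= dy1 dy2 subrr.
  have hu' : gr_int_comp (n + t%:Z + t%:Z) u by apply: gr_int_comp_eq hu _; lia.
  exists t, u; split=> // triv; apply: ncob.
  exact/(connecting_coboundary hy1 hy2 hy ay1 by2 dy1 dy2 (esym dy) hu' yu).
- have [y hy yE] : exists2 y, gm_comp (E 0%N) n y & (a * b) ^+ t *: y = eps u.
    by apply: divisible (hmX t) _ _ => //; apply: eps_hom;
      apply: gr_int_comp_eq hu _; lia.
  have hdy : gm_comp (E 1%N) n (d 0%N y) by apply: d_hom.
  have [|z [hz az bz]] := split_ab hdy.
    by exists t; rewrite -linearZ /= yE d_eps.
  pose z2 := z - d 0%N y.
  have hz2 : gm_comp (E 1%N) n z2 by apply: gm_compB.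
  have bz2 : powtorsion b z2 by rewrite /z2 -opprB -[- _]add0r;
    apply: powtorsionB => //; apply: powtorsion0.
  have dz2 : d 1%N z2 = d 1%N z by rewrite linearB /= d_d subr0.
  have zy : z - z2 = d 0%N y by rewrite /z2 subKr.
  exists (d 1%N z); split.
  + apply/torsionP; split; first exact: powtorsion_linear.
    by rewrite -dz2; apply: powtorsion_linear.
  + exact: d_hom.
  + exact: d_d.
  by move/(connecting_coboundary hz hz2 hy az bz2 erefl dz2 zy hu yE).
Qed.

(** The Mayer-Vietoris sequence puts H^(i+3) between H^(i+2) with support in
a b and H^(i+3) with support in a or b, and these vanish by
[powtorsion_cocycleS]. *)
Lemma lc_ge3_vanishes i n : ~ lc_neq0 E i.+3 n.
Proof.
move=> [x [/torsionP[ax bx] hx dx]]; apply.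
have [y1 [hy1 ay1 dy1]] := powtorsion_cocycleS ha ra hx ax dx.
have [y2 [hy2 by2 dy2]] := powtorsion_cocycleS hb rb hx bx dx.
have [||||z [hz abz dz]] := @powtorsion_cocycleS (a * b) 2 i n (y1 - y2) hm.
- exact: rab.
- exact: gm_compB.
- by apply: powtorsionB; [rewrite mulrC;
  apply: powtorsion_mull | apply: powtorsion_mull].
- by rewrite linearB /= dy1 dy2 subrr.
have [g [hg ag bg]] := split_ab hz abz.
exists (y1 - d i.+1 g); split.
- apply/torsionP; split; first by apply: powtorsionB => //;
  apply: powtorsion_linear.
  have -> : y1 - d i.+1 g = y2 + d i.+1 (z - g).
    by rewrite linearB /= dz addrA [y2 + _]addrC subrK.
  by apply: powtorsionD => //; apply: powtorsion_linear.
- by apply: gm_compB => //; apply: d_hom.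
- by rewrite linearB /= d_d subr0.
Qed.

(** The nonzero class in degree -1 makes the regularity an integer, which is
attained by H^1 or H^2. *)
Lemma regularity_exists (N : int) :
  (forall n, cech1 a b n -> n <= N) -> (forall n, cech2 a b n -> n <= N) ->
  cech2 a b (-1) ->
  exists r, [/\ is_regularity E (Some r),
    forall n, cech1 a b n -> n + 1 <= r, forall n, cech2 a b n -> n + 2 <= r &
    cech1 a b (r - 1) \/ cech2 a b (r - 2)].
Proof.
move=> N1 N2 cm1.
have [o1 ho1] := max_exists N1; have [o2 ho2] := max_exists N2.
pose al i := match i with 1 => o1 | 2 => o2 | _ => None end.
have hal i : is_a_invariant E i (al i).
  have none j : (forall n, ~ lc_neq0 E j n) -> is_a_invariant E j None.
    by move=> h; rewrite /is_a_invariant /is_max -subset0 => n /h.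
  have some j (S : set int) o : (forall n, lc_neq0 E j n <-> S n) ->
      is_max S o -> is_a_invariant E j o.
    by move=> h; rewrite /is_a_invariant; have -> : [set n | lc_neq0 E j n] = S
      by apply/predeqP.
  case: i => [|[|[|i]]] /=.
  - exact: none lc0_vanishes.
  - exact: some lc1_cech ho1.
  - exact: some lc2_cech ho2.
  - exact: none (@lc_ge3_vanishes i).
pose T : set int := [set m | exists i n, al i = Some n /\ m = n + i%:Z].
have hT m : T m -> m <= N + 2.
  move=> [[|[|[|i]]] [n [//= e ->]]].
    by move: ho1; rewrite e => -[/N1 h _]; lia.
  by move: ho2; rewrite e => -[/N2 h _]; lia.
have ub1 n : cech1 a b n -> exists2 m, T m & n + 1 <= m.
  move=> hn; case: o1 ho1 @al hal @T hT => [m [_ h]|h0] al _ T _.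
    by exists (m + 1); [exists 1%N, m | rewrite lerD2r; apply: h].
  by have : [set n | cech1 a b n] n by []; rewrite h0.
have ub2 n : cech2 a b n -> exists2 m, T m & n + 2 <= m.
  move=> hn; case: o2 ho2 @al hal @T hT ub1 => [m [_ h]|h0] al _ T _ _.
    by exists (m + 2); [exists 2%N, m | rewrite lerD2r; apply: h].
  by have : [set n | cech2 a b n] n by []; rewrite h0.
have [[r [Tr rP]|T0]] := max_exists hT; last first.
  by have [m] := ub2 _ cm1; rewrite T0.
exists r; split.
- by exists al.
- by move=> n /ub1[m /rP mr] h; apply: le_trans h mr.
- by move=> n /ub2[m /rP mr] h; apply: le_trans h mr.
- move: Tr => [[|[|[|i]]] [n [//= e ->]]].
    by left; move: ho1; rewrite e addrK => -[].
  by right; move: ho2; rewrite e addrK => -[].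
Qed.
End LocalCohomologyOfPair.
End CechPairs.
End TwoElements.

(** The class of H^2 in degree -1 contributes 1 to the regularity, so H^1
matters in degrees n >= 0 and H^2 in degrees n >= -1 only. *)
Lemma regularity_transfer (A A' : graded_ring) (a b : A) (a' b' : A')
    (N : nat)
    (E : injective_resolution (regular_module A))
    (E' : injective_resolution (regular_module A')) :
  cech_pair a b -> cech_pair a' b' ->
  (forall n : nat, cech1 a b n%:Z <-> cech1 a' b' n%:Z) ->
  (forall n : nat, cech2 a b n%:Z <-> cech2 a' b' n%:Z) ->
  cech2 a b (-1) -> cech2 a' b' (-1) ->
  (forall n : nat, cech1 a b n%:Z -> (n <= N)%N) ->
  (forall n : nat, cech2 a b n%:Z -> (n <= N)%N) ->
  exists r : option int, is_regularity E r /\ is_regularity E' r.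
Proof.
move=> hab hab' e1 e2 m1 m1' N1 N2.
have ub (S : set int) : (forall n : nat, S n%:Z -> (n <= N)%N) ->
    forall n, S n -> n <= N%:Z.
  by move=> h [n /h|n _]; lia.
have N1' (n : nat) : cech1 a' b' n%:Z -> (n <= N)%N by move=> /e1/N1.
have N2' (n : nat) : cech2 a' b' n%:Z -> (n <= N)%N by move=> /e2/N2.
have [r [hr r1 r2 r3]] := regularity_exists hab E (ub _ N1) (ub _ N2) m1.
have [s [hs s1 s2 s3]] := regularity_exists hab' E' (ub _ N1') (ub _ N2') m1'.
have rpos : 1 <= r by have := r2 _ m1; lia.
have spos : 1 <= s by have := s2 _ m1'; lia.
suff rs : r = s by exists (Some r); split=> //; rewrite rs.
apply/le_anti/andP; split.
- case: r3 => h.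
    have rE : r - 1 = `|r - 1|%N%:Z by lia.
    by rewrite rE in h; have := s1 _ ((e1 _).1 h); rewrite -rE subrK.
  have [r1E|r2p] := eqVneq r 1; first by rewrite r1E.
  have rE : r - 2 = `|r - 2|%N%:Z by lia.
  by rewrite rE in h; have := s2 _ ((e2 _).1 h); rewrite -rE subrK.
- case: s3 => h.
    have sE : s - 1 = `|s - 1|%N%:Z by lia.
    by rewrite sE in h; have := r1 _ ((e1 _).2 h); rewrite -sE subrK.
  have [s1E|s2p] := eqVneq s 1; first by rewrite s1E.
  have sE : s - 2 = `|s - 2|%N%:Z by lia.
  by rewrite sE in h; have := r2 _ ((e2 _).2 h); rewrite -sE subrK.
Qed.

(** * Monomials in two variables *)

Definition mon (p q : nat) : 'X_{1..2} :=
  [multinom if i == ord0 then p else q | i < 2].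

Lemma mon0E p q : mon p q ord0 = p. Proof. by rewrite mnmE. Qed.
Lemma mon1E p q : mon p q ord_max = q. Proof. by rewrite mnmE. Qed.

Lemma ord2P (i : 'I_2) : i = ord0 \/ i = ord_max.
Proof. by case: i => -[|[|//]] h; [left|right]; apply: val_inj. Qed.

Lemma mnm2P (m m' : 'X_{1..2}) :
  m ord0 = m' ord0 -> m ord_max = m' ord_max -> m = m'.
Proof. by move=> h0 h1; apply/mnmP => i; case: (ord2P i) => ->. Qed.

Lemma monD p q p' q' : (mon p q + mon p' q')%MM = mon (p + p') (q + q').
Proof. by apply: mnm2P; rewrite mnmDE !(mon0E, mon1E). Qed.

Lemma mon_eta (m : 'X_{1..2}) : m = mon (m ord0) (m ord_max).
Proof. by apply: mnm2P; rewrite (mon0E, mon1E). Qed.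

Lemma mdeg2 (m : 'X_{1..2}) : mdeg m = (m ord0 + m ord_max)%N.
Proof.
by rewrite mdegE big_ord_recl big_ord1; congr (_ + m _)%N; apply: val_inj.
Qed.

Section Monomials.
Variable k : fieldType.
Local Notation P := {mpoly k[2]}.
Implicit Types (f g h : P) (m : 'X_{1..2}).

Lemma mcoeff_Xmul m f m' : ('X_[m] * f)@_(m + m') = f@_m'.
Proof. by rewrite mulrC mcoeffMX. Qed.

Lemma msupp_Xmul m f m' :
  m' \in msupp ('X_[m] * f) -> exists2 m1, m1 \in msupp f & m' = (m + m1)%MM.
Proof. by rewrite mulrC (perm_mem (msuppMX _ _)) => /mapP[m1]; exists m1. Qed.

Lemma mem_msupp_Xmul m f m' :
  ((m + m')%MM \in msupp ('X_[m] * f)) = (m' \in msupp f).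
Proof. by rewrite !mcoeff_msupp mcoeff_Xmul. Qed.

Lemma Xmul_inj m : injective (fun f => 'X_[k, m] * f).
Proof.
by move=> f g /= fg; apply/mpolyP => m';
  rewrite -(mcoeff_Xmul m) fg mcoeff_Xmul.
Qed.

Lemma mpoly_divX m f : (forall m', m' \in msupp f -> (m <= m')%MM) ->
  exists h, f = 'X_[m] * h.
Proof.
move=> hm; exists (\sum_(m' <- msupp f) f@_m' *: 'X_[m' - m]).
rewrite {1}[f]mpolyE mulr_sumr big_seq [RHS]big_seq; apply: eq_bigr => m' /hm h.
by rewrite -scalerAr -mpolyXD addmC submK.
Qed.

Lemma mpoly_split (Q : 'X_{1..2} -> Prop) f : exists f1 f2, f = f1 + f2 /\
  (forall m, m \in msupp f1 -> m \in msupp f /\ Q m) /\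
  (forall m, m \in msupp f2 -> m \in msupp f /\ ~ Q m).
Proof.
pose restr (R : 'X_{1..2} -> bool) :=
  \sum_(m <- msupp f | R m) f@_m *: 'X_[k, m].
have restrP (R : 'X_{1..2} -> bool) m :
    m \in msupp (restr R) -> m \in msupp f /\ R m.
  rewrite /restr => /msupp_sum_le/flatten_mapP[m' m'f]; move: m'f.
  rewrite mem_filter => /andP[Rm' m'f] /msuppZ_le.
  by rewrite msuppX inE => /eqP ->.
exists (restr (fun m => `[< Q m >])), (restr (fun m => ~~ `[< Q m >])).
split; first by rewrite {1}[f]mpolyE (bigID (fun m => `[< Q m >])).
split=> m /restrP[mf hm]; split=> //; [exact/asboolP | exact/asboolPn].
Qed.

Lemma msuppD_mem f g m : m \in msupp (f + g) -> m \in msupp f \/ m \in msupp g.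
Proof. by move=> /msuppD_le; rewrite mem_cat => /orP. Qed.

(** A fraction with denominators x^c and y^c is a polynomial, by comparing
monomials. *)
Lemma Xmul_eq c f g : 'X_[mon c 0] * f = 'X_[mon 0 c] * g ->
  exists h, f = 'X_[mon 0 c] * h /\ g = 'X_[mon c 0] * h.
Proof.
move=> fg; have [|h fh] := @mpoly_divX (mon 0 c) f.
  move=> m; rewrite -(mem_msupp_Xmul (mon c 0)) fg => /msupp_Xmul[m1 _].
  move=> /(congr1 (fun m : 'X_{1..2} => m ord_max)).
  rewrite !mnmDE !mon1E add0n => mE; apply/mnm_lepP => i.
  by case: (ord2P i) => ->; rewrite ?mon0E ?mon1E ?mE ?leq_addr.
exists h; split=> //; apply: (@Xmul_inj (mon 0 c)) => /=.
by rewrite -fg fh mulrCA.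
Qed.

End Monomials.

(** * Graded rings spanned by monomials *)

Section MonomialModel.
Variables (k : fieldType) (A : graded_ring) (S : nat -> nat -> nat -> Prop).
Variables (phi : nat -> A -> {mpoly k[2]}) (d : nat) (a b : A).
Implicit Types (u v w : A) (m : 'X_{1..2}).

Definition in_S n (f : {mpoly k[2]}) : Prop :=
  forall m, m \in msupp f -> S n (m ord0) (m ord_max).

(** A is a graded ring whose degree n part is identified by phi n with the
span of the monomials x^p y^q such that S n p q, and a and b are x^d and y^d
in degree 1. *)
Record monomial_model : Prop := MonomialModel {
  mm_one : phi 0 1 = 1;
  mm_add : forall n u v, gr_comp A n u -> gr_comp A n v ->
    phi n (u + v) = phi n u + phi n v;
  mm_mul : forall i j u v, gr_comp A i u -> gr_comp A j v ->
    phi (i + j) (u * v) = phi i u * phi j v;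
  mm_inj : forall n u v, gr_comp A n u -> gr_comp A n v ->
    phi n u = phi n v -> u = v;
  mm_supp : forall n u, gr_comp A n u -> in_S n (phi n u);
  mm_surj : forall n f, in_S n f -> exists2 u, gr_comp A n u & phi n u = f;
  mm_a : gr_comp A 1 a;
  mm_b : gr_comp A 1 b;
  mm_phia : phi 1 a = 'X_[mon d 0];
  mm_phib : phi 1 b = 'X_[mon 0 d] }.

Hypothesis model : monomial_model.

Let aX r : gr_comp A r (a ^+ r).
Proof.
elim: r => [|r IH]; first exact: gr_one.
by rewrite exprS -[r.+1]add1n; apply: gr_mul => //; apply: mm_a.
Qed.

Let bX r : gr_comp A r (b ^+ r).
Proof.
elim: r => [|r IH]; first exact: gr_one.
by rewrite exprS -[r.+1]add1n; apply: gr_mul => //; apply: mm_b.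
Qed.

Lemma phi_aX r : phi r (a ^+ r) = 'X_[mon (d * r) 0].
Proof.
elim: r => [|r IH].
  rewrite expr0 mm_one // muln0.
  have -> : mon 0 0 = 0%MM by apply: mnm2P; rewrite ?mon0E ?mon1E mnm0E.
  by rewrite mpolyX0.
rewrite exprS -[r.+1]add1n mm_mul ?mm_a // mm_phia // IH -mpolyXD monD.
by rewrite mulnDr muln1 add0n.
Qed.

Lemma phi_bX r : phi r (b ^+ r) = 'X_[mon 0 (d * r)].
Proof.
elim: r => [|r IH].
  rewrite expr0 mm_one // muln0.
  have -> : mon 0 0 = 0%MM by apply: mnm2P; rewrite ?mon0E ?mon1E mnm0E.
  by rewrite mpolyX0.
rewrite exprS -[r.+1]add1n mm_mul ?mm_b // mm_phib // IH -mpolyXD monD.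
by rewrite mulnDr muln1 add0n.
Qed.

Lemma phi_aXM r n u : gr_comp A n u ->
  phi (r + n) (a ^+ r * u) = 'X_[mon (d * r) 0] * phi n u.
Proof. by move=> hu; rewrite mm_mul // phi_aX. Qed.

Lemma phi_bXM r n u : gr_comp A n u ->
  phi (r + n) (b ^+ r * u) = 'X_[mon 0 (d * r)] * phi n u.
Proof. by move=> hu; rewrite mm_mul // phi_bX. Qed.

Lemma comp0 n : gr_comp A n 0.
Proof. by have [h _ _ _] := gr_sum A; apply: (h n). Qed.

Lemma phi0 n : phi n 0 = 0.
Proof.
apply/(addrI (phi n 0)); rewrite -mm_add ?addr0 //; exact: comp0.
Qed.

Let regular c e : gr_comp A 1 c -> phi 1 c = 'X_[e] -> hom_regular c.
Proof.
move=> hc ce [n|n] u /= hu cu //; apply: (mm_inj model hu (comp0 n)).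
apply: (@Xmul_inj k e); rewrite /= phi0 mulr0 -ce -mm_mul // cu.
exact: phi0.
Qed.

Lemma cech_relation n r u v :
  gr_comp A (n + r) u -> gr_comp A (n + r) v -> a ^+ r * u = b ^+ r * v ->
  exists h, phi (n + r) u = 'X_[mon 0 (d * r)] * h /\
            phi (n + r) v = 'X_[mon (d * r) 0] * h.
Proof.
move=> hu hv uv; apply: Xmul_eq; rewrite -phi_aXM // -phi_bXM //.
by rewrite uv.
Qed.

Lemma in_S_mon n p q : S n p q <-> in_S n 'X_[mon p q].
Proof.
split=> [h m|]; first by rewrite msuppX inE => /eqP ->; rewrite mon0E mon1E.
by move=> /(_ (mon p q)); rewrite msuppX inE eqxx mon0E mon1E; apply.
Qed.

Lemma in_SD n f g : in_S n f -> in_S n g -> in_S n (f + g).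
Proof. by move=> hf hg m /msuppD_mem[/hf|/hg]. Qed.

Lemma mem_shift n f c e : in_S n ('X_[mon c e] * f) ->
  forall m, m \in msupp f -> S n (c + m ord0) (e + m ord_max).
Proof.
move=> h m hm; have := h (mon c e + m)%MM; rewrite mem_msupp_Xmul => /(_ hm).
by rewrite !mnmDE mon0E mon1E.
Qed.

(** The reduction splits an element into the monomials that are x^d times one
of degree n, and the others. *)
Lemma model_cech_pair :
  (exists N, forall n p q, (N <= n)%N -> S n.+1 p q ->
     (d <= p)%N /\ S n (p - d) q \/ (d <= q)%N /\ S n p (q - d)) ->
  (exists N, forall n r p q, (N <= n)%N ->
     S (n + r) p (d * r + q) -> S (n + r) (d * r + p) q -> S n p q) ->
  cech_pair a b.
Proof.
move=> [N1 red] [N2 sat]; split.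
- exact: mm_a.
- exact: mm_b.
- exact: regular (mm_a model) (mm_phia model).
- exact: regular (mm_b model) (mm_phib model).
- exists N1 => n u nN hu.
  have [f1 [f2 [fE [f1P f2P]]]] := mpoly_split
    (fun m => (d <= m ord0)%N /\ S n (m ord0 - d) (m ord_max)) (phi n.+1 u).
  have f2Q m : m \in msupp f2 -> (d <= m ord_max)%N /\ S n (m ord0) (m ord_max
    - d).
    move=> /f2P[/(mm_supp model hu) h nq].
    by case: (red n _ _ nN h).
  have [h1 h1E] : exists h, f1 = 'X_[mon d 0] * h.
    apply: mpoly_divX => m /f1P[_ [dm _]]; apply/mnm_lepP => i.
    by case: (ord2P i) => ->; rewrite ?mon0E ?mon1E.
  have [h2 h2E] : exists h, f2 = 'X_[mon 0 d] * h.
    apply: mpoly_divX => m /f2Q[dm _]; apply/mnm_lepP => i.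
    by case: (ord2P i) => ->; rewrite ?mon0E ?mon1E.
  have [u1 hu1 u1E] : exists2 u1, gr_comp A n u1 & phi n u1 = h1.
    apply: mm_surj => // m; rewrite -(mem_msupp_Xmul (mon d 0)) -h1E.
    by move=> /f1P[_ [_]]; rewrite !mnmDE mon0E mon1E addKn.
  have [u2 hu2 u2E] : exists2 u2, gr_comp A n u2 & phi n u2 = h2.
    apply: mm_surj => // m; rewrite -(mem_msupp_Xmul (mon 0 d)) -h2E.
    by move=> /f2Q[_]; rewrite !mnmDE mon0E mon1E addKn.
  exists u1, u2; split=> //.
  have c1 : gr_comp A n.+1 (a * u1) by rewrite -add1n; apply/gr_mul/hu1/mm_a.
  have c2 : gr_comp A n.+1 (b * u2) by rewrite -add1n; apply/gr_mul/hu2/mm_b.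
  apply: (mm_inj model hu); first exact: (gr_int_compD (n := n.+1)).
  rewrite (mm_add model c1 c2) -[n.+1]add1n !mm_mul ?mm_a ?mm_b // mm_phia //
    mm_phib //.
  by rewrite u1E u2E -h1E -h2E.
- exists N2 => n r u v nN hu hv uv.
  have [h [uE vE]] := cech_relation hu hv uv.
  have [w hw wE] : exists2 w, gr_comp A n w & phi n w = h.
    apply: mm_surj => // m hm; apply: (sat n r) => //.
      by have := mm_supp model hu; rewrite uE => /mem_shift/(_ _ hm).
    by have := mm_supp model hv; rewrite vE => /mem_shift/(_ _ hm).
  exists w => //; apply: (mm_inj model hu); first by rewrite addnC;
    apply: gr_mul.
  by rewrite [in RHS]addnC phi_bXM // wE.
Qed.
(** The monomial x^p y^q is missing in degree n, but it is a fraction with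
denominator b^r and with denominator a^r. *)
Definition sat_gap (n : nat) : Prop := exists r p q,
  [/\ S (n + r) p (d * r + q), S (n + r) (d * r + p) q & ~ S n p q].

Lemma model_cech1 (n : nat) : cech1 a b n%:Z <-> sat_gap n.
Proof.
split=> [[r [u [v [hu hv uv nw]]]]|[r [p [q [h1 h2 nS]]]]].
- have [h [uE vE]] := @cech_relation n r u v hu hv uv.
  have [hS|nS] := pselect (in_S n h).
    have [w hw wE] := mm_surj model hS; case: nw; exists w => //.
    apply: (mm_inj model (n := (n + r)%N)) => //; first by rewrite addnC;
      apply: gr_mul.
    by rewrite [in RHS]addnC phi_bXM // wE.
  have [m /not_implyP[hm hmS]] := (existsNP _).2 nS.
  exists r, (m ord0), (m ord_max); split=> //.
    by have := mm_supp model (n := (n + r)%N) hu;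
      rewrite uE => /mem_shift/(_ _ hm).
  by have := mm_supp model (n := (n + r)%N) hv;
    rewrite vE => /mem_shift/(_ _ hm).
- have [u hu uE] := mm_surj model ((in_S_mon _ _ _).1 h1).
  have [v hv vE] := mm_surj model ((in_S_mon _ _ _).1 h2).
  exists r, u, v; split=> //.
    apply: (mm_inj model (n := (r + (n + r))%N));
      [exact: gr_mul | exact: gr_mul |].
    by rewrite phi_aXM // phi_bXM // uE vE -!mpolyXD !monD !add0n.
  move=> [w hw uw]; apply: nS; apply/in_S_mon.
  have wE : phi n w = 'X_[mon p q].
    apply: (@Xmul_inj k (mon 0 (d * r))) => /=.
    by rewrite -phi_bXM // -uw addnC uE -mpolyXD monD.
  by rewrite -wE; exact: (mm_supp model hw).
Qed.

(** A monomial of A_ab, the quotient of x^p y^q by (a b)^t, that lies neither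
in A_a nor in A_b; it has degree c - t, and its numerator has degree c + t. *)
Definition end_gap (c t : nat) : Prop := exists p q,
  S (c + t) p q /\ forall s,
    ~ ((d * t <= p)%N /\ S (c + s) (p - d * t) (d * s + q)) /\
    ~ ((d * t <= q)%N /\ S (c + s) (d * s + p) (q - d * t)).

Definition cech_trivial (c t : nat) (u : A) : Prop := exists s p q,
  [/\ gr_comp A (c + s) p, gr_comp A (c + s) q &
      (a * b) ^+ s * u = a ^+ (t + s) * p + b ^+ (t + s) * q].

(** Multiplying by a power of a b allows two trivializations to be compared. *)
Lemma cech_trivial_widen c t u s s' p q : (s <= s')%N ->
  gr_comp A (c + s) p -> gr_comp A (c + s) q ->
  (a * b) ^+ s * u = a ^+ (t + s) * p + b ^+ (t + s) * q ->
  exists p' q', [/\ gr_comp A (c + s') p', gr_comp A (c + s') q' &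
      (a * b) ^+ s' * u = a ^+ (t + s') * p' + b ^+ (t + s') * q'].
Proof.
move=> /subnKC <- hp hq uE; set e := (s' - s)%N.
have eE : (c + (s + e) = e + (c + s))%N by lia.
exists (b ^+ e * p), (a ^+ e * q); split.
- by rewrite eE; apply: gr_mul.
- by rewrite eE; apply: gr_mul.
- rewrite exprD [_ ^+ s * _]mulrC -mulrA uE addnA !exprMn.
  by rewrite ![_ ^+ (t + s + e)]exprD; ring.
Qed.

Lemma cech_trivialD c t u v :
  cech_trivial c t u -> cech_trivial c t v -> cech_trivial c t (u + v).
Proof.
move=> [s [p [q [hp hq uE]]]] [s' [p' [q' [hp' hq' vE]]]].
have [x [y [hx hy xy]]] := cech_trivial_widen (leq_addr s' s) hp hq uE.
have [x' [y' [hx' hy' xy']]] := cech_trivial_widen (leq_addl s s') hp' hq' vE.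
exists (s + s')%N, (x + x'), (y + y'); split.
- exact: (gr_int_compD (n := (c + (s + s'))%N)).
- exact: (gr_int_compD (n := (c + (s + s'))%N)).
- by rewrite mulrDr xy xy' !mulrDr addrACA.
Qed.

Lemma phi_abXM s n u : gr_comp A n u ->
  phi (s + (s + n)) ((a * b) ^+ s * u) = 'X_[mon (d * s) (d * s)] * phi n u.
Proof.
move=> hu; rewrite exprMn -mulrA phi_aXM; last exact: gr_mul.
by rewrite phi_bXM // mulrA -mpolyXD monD addn0 add0n.
Qed.

Lemma comp_abXM s n u : gr_comp A n u ->
  gr_comp A (s + (s + n)) ((a * b) ^+ s * u).
Proof. by move=> hu; rewrite exprMn -mulrA; do 2!apply: gr_mul => //. Qed.

Lemma in_SZ n z f : in_S n f -> in_S n (z *: f).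
Proof. by move=> h m /msuppZ_le/h. Qed.

Lemma trivial_monomial c t z p q u : ~ end_gap c t ->
  gr_comp A (c + t) u -> S (c + t) p q -> phi (c + t) u = z *: 'X_[mon p q] ->
  cech_trivial c t u.
Proof.
move=> ng hu hS uE.
have [s hs] : exists s,
    (d * t <= p)%N /\ S (c + s) (p - d * t) (d * s + q) \/
    (d * t <= q)%N /\ S (c + s) (d * s + p) (q - d * t).
  apply: contrapT => h; apply: ng; exists p, q; split=> // s.
  by split=> h1; apply: h; exists s; [left | right].
have sE : (s + (s + (c + t)) = (t + s) + (c + s))%N by lia.
exists s; case: hs => -[le hs].
  have [x hx xE] := mm_surj model (in_SZ (z := z) ((in_S_mon _ _ _).1 hs)).
  exists x, 0; split=> //; first exact: comp0.
  rewrite mulr0 addr0; apply: (mm_inj model (comp_abXM s hu)).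
    by rewrite sE; apply: gr_mul.
  rewrite phi_abXM // [in RHS]sE phi_aXM // uE xE -!scalerAr -!mpolyXD !monD.
  by congr (_ *: 'X_[mon _ _]); lia.
have [x hx xE] := mm_surj model (in_SZ (z := z) ((in_S_mon _ _ _).1 hs)).
exists 0, x; split=> //; first exact: comp0.
rewrite mulr0 add0r; apply: (mm_inj model (comp_abXM s hu)).
  by rewrite sE; apply: gr_mul.
rewrite phi_abXM // [in RHS]sE phi_bXM // uE xE -!scalerAr -!mpolyXD !monD.
by congr (_ *: 'X_[mon _ _]); lia.
Qed.

(** A_a and A_b are spanned by monomials, so a polynomial is trivial if all
its monomials are. *)
Lemma end_gapP c t :
  (exists2 u, gr_comp A (c + t) u & ~ cech_trivial c t u) <-> end_gap c t.
Proof.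
split=> [[u hu nu]|[p [q [hS hgap]]]].
- apply: contrapT => ng; apply: nu.
  have sums (r : seq 'X_{1..2}) (z : 'X_{1..2} -> k) :
      (forall m, m \in r -> S (c + t) (m ord0) (m ord_max)) ->
      exists v, [/\ gr_comp A (c + t) v, phi (c + t) v = \sum_(m <- r) z m *:
        'X_[m]
                  & cech_trivial c t v].
    elim: r => [_|m r IH hr].
      exists 0; rewrite big_nil phi0; split=> //; first exact: comp0.
      exists 0%N, 0, 0; rewrite !mulr0 addr0.
      by split=> //; apply: comp0.
    have [|v [hv vE vt]] := IH; first by move=> m' h; apply: hr;
      rewrite inE h orbT.
    have hm : S (c + t) (m ord0) (m ord_max) by apply: hr; rewrite inE eqxx.
    have [x hx xE] := mm_surj model (in_SZ (z := z m) ((in_S_mon _ _ _).1 hm)).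
    exists (x + v); split.
    - exact: (gr_int_compD (n := (c + t)%N)).
    - by rewrite (mm_add model hx hv) big_cons vE xE -mon_eta.
    - by apply: cech_trivialD => //; apply: trivial_monomial xE.
  have [v [hv vE vt]] :=
    sums _ (fun m => (phi (c + t) u)@_m) (mm_supp model hu).
  by rewrite (mm_inj model hu hv) // vE; apply: mpolyE.
- have [u hu uE] := mm_surj model ((in_S_mon _ _ _).1 hS).
  exists u => // -[s [x [y [hx hy xy]]]]; have [n1 n2] := hgap s.
  have sE : (s + (s + (c + t)) = (t + s) + (c + s))%N by lia.
  have := congr1 (phi (s + (s + (c + t)))) xy.
  rewrite phi_abXM // uE [in RHS]sE.
  rewrite (mm_add model); [|exact: gr_mul|exact: gr_mul].
  rewrite phi_aXM // phi_bXM // -mpolyXD monD => fE.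
  have : mon (d * s + p) (d * s + q) \in
      msupp ('X_[k, mon (d * s + p) (d * s + q)]) by rewrite msuppX inE.
  rewrite fE => /msuppD_mem[] /msupp_Xmul[m hm mE].
    have := congr1 (fun m : 'X_{1..2} => m ord0) mE.
    have := congr1 (fun m : 'X_{1..2} => m ord_max) mE.
    rewrite !mnmDE !mon0E !mon1E => e1 e0; apply: n1; split; first lia.
    have -> : (p - d * t = m ord0)%N by lia.
    by rewrite e1 add0n; apply: (mm_supp model hx).
  have := congr1 (fun m : 'X_{1..2} => m ord0) mE.
  have := congr1 (fun m : 'X_{1..2} => m ord_max) mE.
  rewrite !mnmDE !mon0E !mon1E => e1 e0; apply: n2; split; first lia.
  have -> : (q - d * t = m ord_max)%N by lia.
  by rewrite e0 add0n; apply: (mm_supp model hy).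
Qed.

Lemma model_cech2 (n : nat) : cech2 a b n%:Z <-> exists t, end_gap (n + t) t.
Proof.
split=> [[t [u [hu nu]]]|[t /end_gapP[u hu nu]]].
  by exists t; apply/end_gapP; exists u.
by exists t, u.
Qed.

Lemma model_cech2_m1 : end_gap 0 1 -> cech2 a b (-1).
Proof. by move=> /end_gapP[u hu nu]; exists 1%N, u. Qed.

End MonomialModel.

(** * Sumsets *)

Section Sumsets.
Variables (d : nat) (B : nat -> Prop).
Hypotheses (Ble : forall j, B j -> (j <= d)%N).
Hypotheses (B0 : B 0) (B1 : B 1) (Bd : B d).

Fixpoint sumset (n : nat) : nat -> Prop :=
  if n is n'.+1 then fun j => exists x y, [/\ B x, sumset n' y & j = (x + y)%N]
  else fun j => j = 0%N.

Definition fiber_exp n p q : Prop := (p + q = n * d)%N /\ sumset n q.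

Definition rees_exp n p q : Prop :=
  exists j, [/\ sumset n j, (j <= q)%N & (n * d <= p + j)%N].

(** The numerical semigroup generated by the d - j for j in B: a sum of s
such differences is s d minus an element of the s-fold sumset. *)
Definition end_semigroup (i : nat) : Prop :=
  exists s, (i <= s * d)%N /\ sumset s (s * d - i).

Lemma sumset_le n j : sumset n j -> (j <= n * d)%N.
Proof.
elim: n j => [|n IH] j /=; first by move=> ->.
by move=> [x [y [/Ble hx /IH hy ->]]]; rewrite mulSn leq_add.
Qed.

Lemma sumsetD m n i j : sumset m i -> sumset n j -> sumset (m + n) (i + j).
Proof.
move=> + hj; elim: m i => [|m IH] i /=; first by move=> ->.
by move=> [x [y [hx /IH hy ->]]]; exists x, (y + j)%N; rewrite addnA.
Qed.

Lemma sumset_addd n e j : sumset n j -> sumset (n + e) (j + e * d).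
Proof.
move=> h; elim: e => [|e IH]; first by rewrite !addn0.
by rewrite addnS; exists d, (j + e * d)%N; split=> //; lia.
Qed.

Lemma sumset_small n j : (j <= n)%N -> sumset n j.
Proof.
elim: n j => [|n IH] [|j] //= h; first by exists 0%N, 0%N; split=> //;
  apply: IH.
by exists 1%N, j; split=> //; apply: IH.
Qed.

(** Writes j as j / d summands d followed by j mod d summands 1. *)
Lemma sumset_divn n j : (j %/ d + j %% d <= n)%N -> sumset n j.
Proof.
move=> h; rewrite (divn_eq j d) addnC.
have -> : n = ((n - j %/ d) + j %/ d)%N by lia.
by apply/sumset_addd/sumset_small; lia.
Qed.

(** Splits off the summands equal to d; each of the m others contributes at
least 1 to s d - j. *)
Lemma sumset_normal s j : sumset s j -> exists m j',
  [/\ (m <= s)%N, sumset m j', (j = (s - m) * d + j')%N & (m + j <= s * d)%N].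
Proof.
elim: s j => [|s IH] j /=.
  by move=> ->; exists 0%N, 0%N.
move=> [x [y [hx /IH [m [j' [ms hm yE le]]] ->]]].
have [xd|xd] := eqVneq x d.
  exists m, j'; split=> //; [lia | | by lia].
  by rewrite subSn // mulSn xd yE addnA.
exists m.+1, (x + j')%N; split=> //; first by exists x, j'.
  by rewrite subSS yE; lia.
by have := Ble hx; lia.
Qed.

(** An element i of the semigroup is a sum of at most i nonzero differences d
- j. *)
Lemma end_semigroup_sumset i n :
  end_semigroup i -> (i <= n)%N -> sumset n (n * d - i).
Proof.
move=> [s [si /sumset_normal [m [j' [ms hm jE le]]]]] iln.
have mi : (m <= i)%N by lia.
have sE : (s * d = (s - m) * d + m * d)%N by rewrite -mulnDl subnK.
have nE : (n * d = (n - m) * d + m * d)%N by rewrite -mulnDl subnK //; lia.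
have -> : (n * d - i = j' + (n - m) * d)%N.
  move: sE nE jE si; move: ((s - m) * d)%N ((n - m) * d)%N (s * d)%N (n * d)%N.
  by move=> *; lia.
have {1}-> : n = (m + (n - m))%N by lia.
exact: sumset_addd.
Qed.

Lemma fiber_rees_exp n p q : fiber_exp n p q -> rees_exp n p q.
Proof. by move=> [pq hq]; exists q; split=> //; rewrite pq. Qed.

Lemma rees_fiber_exp n p q : (p + q = n * d)%N -> rees_exp n p q ->
  fiber_exp n p q.
Proof.
by move=> pq [j [hj jq h]]; split=> //; have <- : j = q by lia.
Qed.

Lemma rees_exp_small n s p q : (n * d <= p + q)%N -> (q <= n + s)%N ->
  rees_exp (n + s) (d * s + p) q.
Proof.
by move=> pq qn; exists q; split=> //; [exact: sumset_small | lia].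
Qed.

Lemma sumset_end n j : sumset n j -> end_semigroup (n * d - j).
Proof.
move=> h; exists n; split; first exact: leq_subr.
by rewrite subKn //; exact: sumset_le h.
Qed.

Lemma end_gap_fiber_rees c t : end_gap fiber_exp d c t ->
  end_gap rees_exp d c t.
Proof.
move=> [p [q [hS h]]]; exists p, q; split; first exact: fiber_rees_exp.
move=> s; have [n1 n2] := h s; have [pq _] := hS; rewrite mulnDl in pq.
split=> -[le hs]; [apply: n1 | apply: n2]; split=> //; apply: rees_fiber_exp hs.
  by rewrite mulnDl; lia.
by rewrite mulnDl; lia.
Qed.

Hypothesis hd : (2 <= d)%N.

(** Since 0 and 1 lie in B, d and d - 1 lie in the semigroup: i is s d - v
with v <= d <= s. *)
Lemma end_semigroup_large i : (d * d <= i)%N -> end_semigroup i.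
Proof.
move=> h; have d0 : (0 < d)%N by lia.
have := divn_eq i d; have := ltn_pmod i d0; set l := (i %/ d)%N => h1 h2.
have dl : (d <= l)%N by rewrite leq_divRL.
exists l.+1; split; first by rewrite mulSn; lia.
by apply: sumset_small; rewrite mulSn; lia.
Qed.

(** The two necessary conditions for q to lie in nB, namely q >= 0 and nd - q
in the semigroup, are sufficient for large n. If p <= n,
[end_semigroup_sumset] applies; otherwise q is far from nd, which leaves
enough summands for [sumset_divn]. *)
Lemma sumset_saturated n p q : (d * d <= n)%N -> (p + q = n * d)%N ->
  end_semigroup p -> sumset n q.
Proof.
move=> dn pq hp; have [pn|np] := leqP p n.
  by have := end_semigroup_sumset hp pn; have -> : (n * d - p = q)%N by lia.
have d0 : (0 < d)%N by lia.
apply: sumset_divn; have := ltn_pmod q d0 => h.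
have dd : (d <= n)%N by apply: leq_trans dn; rewrite leq_pmulr.
have qE : (q <= (n - d) * d)%N by rewrite mulnBl; lia.
have : (q %/ d <= n - d)%N by rewrite -[leqRHS](mulnK _ d0); apply: leq_div2r.
lia.
Qed.
Let sq : (d <= d * d)%N. Proof. by apply: leq_pmulr; apply: leq_trans hd. Qed.

(** For large n the exponents of degree n + 1 come from those of degree n by
adding 0 or d, that is, a and b generate a reduction of I. *)
Lemma sumset_reduction n j : (d * d <= n)%N -> sumset n.+1 j ->
  (d <= j)%N /\ sumset n (j - d) \/ (j < d)%N /\ sumset n j.
Proof.
move=> dn hj; have [dj|jd] := leqP d j; [left|right]; split=> //.
  apply: (@sumset_saturated n (n.+1 * d - j)) => //; last exact: sumset_end.
  by have := sumset_le hj; rewrite mulSn; lia.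
by apply: sumset_small; have := sq; lia.
Qed.

Lemma fiber_exp_reduction n p q : (d * d <= n)%N -> fiber_exp n.+1 p q ->
  (d <= p)%N /\ fiber_exp n (p - d) q \/ (d <= q)%N /\ fiber_exp n p (q - d).
Proof.
move=> dn [pq /(sumset_reduction dn)]; rewrite mulSn in pq.
move=> [[dq hq]|[qd hq]]; [right|left]; split=> //; try by split=> //; lia.
  have : (d <= n * d)%N by apply: leq_pmull; have := sq; lia.
  lia.
split=> //; have : (d <= n * d)%N by apply: leq_pmull; have := sq; lia.
lia.
Qed.

Lemma rees_exp_reduction n p q : (d * d <= n)%N -> rees_exp n.+1 p q ->
  (d <= p)%N /\ rees_exp n (p - d) q \/ (d <= q)%N /\ rees_exp n p (q - d).
Proof.
move=> dn [j [/(sumset_reduction dn) h jq le]]; rewrite mulSn in le.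
case: h => [[dj hj]|[jd hj]]; [right|left].
  by split; first lia; exists (j - d)%N; split=> //; lia.
have nd : (d <= n * d)%N by apply: leq_pmull; have := sq; lia.
by split; first lia; exists j; split=> //; lia.
Qed.

Lemma fiber_exp_saturated n r p q : (d * d <= n)%N ->
  fiber_exp (n + r) p (d * r + q) -> fiber_exp n p q.
Proof.
move=> dn [pq /sumset_end hq]; rewrite mulnDl in pq hq.
have pqn : (p + q = n * d)%N by lia.
split=> //; apply: (@sumset_saturated n p) => //.
by have <- : (n * d + r * d - (d * r + q) = p)%N by lia.
Qed.

(** Conversely to the inclusion of exponents, let x^p y^q be missing from the
Rees algebra in degree n while j1 in (n+r)B witnesses that x^p y^(q+dr) is
present. Then j = j1 - d r is missing from nB, and it is positive since
otherwise 0 would be a witness for x^p y^q. After enlarging r to r + j,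
x^(nd-j) y^j is a gap of the fiber ring. *)
Lemma sat_gap_fiber_rees n :
  sat_gap fiber_exp d n <-> sat_gap rees_exp d n.
Proof.
split=> -[r [p [q [h1 h2 nS]]]].
  exists r, p, q; split; [exact: fiber_rees_exp | exact: fiber_rees_exp |].
  move=> h; apply: nS; apply: rees_fiber_exp h.
  by case: h1; rewrite mulnDl; lia.
have [j1 [hj1 j1q le]] := h1; have j1n := sumset_le hj1.
rewrite mulnDl in le j1n.
have rj1 : (d * r < j1)%N.
  rewrite ltnNge; apply/negP => j1r; apply: nS; exists 0%N; split=> //.
    exact: sumset_small.
  by lia.
pose j := (j1 - d * r)%N; exists (r + j)%N, (n * d - j)%N, j; split.
- split; first by rewrite !mulnDl !mulnDr /j; lia.
  have -> : (d * (r + j) + j = j1 + j * d)%N by rewrite mulnDr /j; lia.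
  by rewrite addnA; apply: sumset_addd.
- split; first by rewrite !mulnDl !mulnDr /j; lia.
  by apply: sumset_small; lia.
- move=> [_ hj]; apply: nS; exists j; split=> //; rewrite /j; lia.
Qed.

Lemma sat_gap_bound n : sat_gap rees_exp d n -> (n <= d * d)%N.
Proof.
move=> /sat_gap_fiber_rees [r [p [q [h1 _ nS]]]].
rewrite leqNgt; apply/negP => dn; apply: nS.
by apply: fiber_exp_saturated h1; apply: ltnW.
Qed.

(** The missing integer is i = p - d t: if it were in the semigroup, then (a
b)^i x^p y^q would be a multiple of a^(t+i). The other alternative is
excluded because 0 and 1 lie in B, which gives q < d t. *)
Lemma end_gap_rees n t : end_gap rees_exp d (n + t) t ->
  exists2 i, (n * d < i)%N & ~ end_semigroup i.
Proof.
move=> [p [q [[j [hj jq le]] h]]]; rewrite !mulnDl in le.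
have qt : (q < d * t)%N.
  rewrite ltnNge; apply/negP => tq; have [_] := h q; apply; split=> //.
  by apply: rees_exp_small; [rewrite mulnDl; lia | lia].
have [i iE] : exists i, i = (p - d * t)%N by exists (p - d * t)%N.
exists i; first lia.
move=> hi; have [+ _] := h i; apply; rewrite -iE; split; first lia.
exists ((n + t + i) * d - i)%N; rewrite !mulnDl; split; last lia.
- by rewrite -!mulnDl; apply: end_semigroup_sumset => //; lia.
- lia.
Qed.

Lemma end_gap_bound n t : end_gap rees_exp d (n + t) t -> (n <= d * d)%N.
Proof.
move=> /end_gap_rees[i ni hi]; rewrite leqNgt; apply/negP => dn; apply: hi.
apply: end_semigroup_large; apply: leq_trans (ltnW ni).
by apply: leq_mul => //; have := sq; lia.
Qed.

(** The class is y^(nd-i) x^i, where nd - i < 0 keeps it out of A_a, and A_b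
is excluded because i is not in the semigroup; t = d + i is large enough for
its numerator to have exponents in the sumset. *)
Lemma end_gap_fiber n i : (n * d < i)%N -> ~ end_semigroup i ->
  exists t, end_gap fiber_exp d (n + t) t.
Proof.
move=> ni hi; have [t tE] : exists t, t = (d + i)%N by exists (d + i)%N.
have itn : (i <= (t + n) * d)%N.
  by apply: (@leq_trans (t + n)); [lia | apply: leq_pmulr; lia].
have itnE := mulnDl t n d.
exists t, (d * t + i)%N, ((t + n) * d - i)%N; split.
  split; first by rewrite !mulnDl; lia.
  apply: sumset_divn; have d0 : (0 < d)%N by lia.
  have := ltn_pmod ((t + n) * d - i) d0.
  have : (((t + n) * d - i) %/ d <= t + n)%N.
    by rewrite -[leqRHS](mulnK _ d0); apply: leq_div2r; apply: leq_subr.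
  lia.
move=> s; split=> -[le hs]; last by lia.
apply: hi; exists (n + t + s)%N; have [e h] := hs.
rewrite addKn in e; split; first lia.
by have -> : ((n + t + s) * d - i = d * s + ((t + n) * d - i))%N by lia.
Qed.

Lemma end_gap_iff n : (exists t, end_gap fiber_exp d (n + t) t) <->
  (exists t, end_gap rees_exp d (n + t) t).
Proof.
split=> [[t /end_gap_fiber_rees h]|[t /end_gap_rees[i ni hi]]];
  first by exists t.
exact: end_gap_fiber ni hi.
Qed.

(** The fraction x^(d-1) y / (x^d y^d) = 1 / (x y^(d-1)), of degree -1. *)
Lemma end_gap_fiber0 : end_gap fiber_exp d 0 1.
Proof.
exists d.-1, 1%N; split; first by split; [lia | exact: sumset_small].
by move=> s; split=> -[h _]; lia.
Qed.
End Sumsets.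

(** * The Rees algebra and the fiber ring *)

Section MonomialIdeals.
Variable k : fieldType.
Local Notation P := {mpoly k[2]}.
Implicit Types (f g : P) (m : 'X_{1..2}) (U V : set 'X_{1..2}).

Definition supp_in U : set P := [set f | forall m, m \in msupp f -> U m].

Definition mnm_upset U : Prop := forall m m', U m -> U (m' + m)%MM.

Definition mnm_add U V : set 'X_{1..2} :=
  [set m | exists u v, [/\ U u, V v & m = (u + v)%MM]].

Lemma supp_in_sum U (T : eqType) (r : seq T) (F : T -> P) :
  (forall i, i \in r -> supp_in U (F i)) -> supp_in U (\sum_(i <- r) F i).
Proof.
move=> h m /msupp_sum_le/flatten_mapP[i].
by rewrite mem_filter => /andP[_ ir]; exact: h.
Qed.

Lemma supp_inM U f g : mnm_upset U -> supp_in U g -> supp_in U (f * g).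
Proof.
move=> hU hg m /msuppM_le/allpairsP[[m1 m2] /= [_ h2 ->]].
by apply: hU; apply: hg.
Qed.

Lemma ideal_gen_monomial (M : set 'X_{1..2}) f :
  ideal_gen [set 'X_[m] | m in M] f <->
  supp_in [set m | exists2 m', M m' & (m' <= m)%MM] f.
Proof.
split=> [[s [hs ->]]|hf].
  apply: supp_in_sum => p /hs[m' Mm' <-]; apply: supp_inM.
    move=> m m1 [m2 h2 le]; exists m2 => //.
    by apply: lepm_trans le _; apply: lem_addl.
  by move=> m; rewrite msuppX inE => /eqP ->; exists m' => //; exact: lepm_refl.
rewrite [f]mpolyE big_seq; apply: ideal_gen_sum => m /hf[m' Mm' le].
rewrite -(submK le) mpolyXD scalerAl; apply: ideal_genM; apply: ideal_gen_mem.
by exists m'.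
Qed.

Lemma ideal_mul_monomial (I J : set P) U V :
  (forall f, I f <-> supp_in U f) -> (forall f, J f <-> supp_in V f) ->
  mnm_upset V -> forall f, ideal_mul I J f <-> supp_in (mnm_add U V) f.
Proof.
move=> IU JV hV f; split=> [[s [hs ->]]|hf].
  apply: supp_in_sum => p /hs[a [b [/IU ha /JV hb ->]]]; apply: supp_inM.
    move=> m m' [u [v [Uu Vv ->]]]; exists u, (m' + v)%MM; split=> //.
      exact: hV.
    by rewrite addmA [(m' + u)%MM]addmC -addmA.
  move=> m /msuppM_le/allpairsP[[m1 m2] /= [h1 h2 ->]].
  by exists m1, m2; split; [exact: ha | exact: hb |].
rewrite [f]mpolyE big_seq; apply: ideal_gen_sum => m /hf[u [v [Uu Vv ->]]].
rewrite mpolyXD -mul_mpolyC; apply: ideal_genM; apply: ideal_mul_mem.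
  by apply/IU => m'; rewrite msuppX inE => /eqP ->.
by apply/JV => m'; rewrite msuppX inE => /eqP ->.
Qed.

Lemma maxideal_monomial f : @maxideal k f <-> supp_in [set m | m <> 0%MM] f.
Proof.
have -> : @maxideal k f = ideal_gen
    [set 'X_[m] | m in [set U_(ord0)%MM; U_(ord_max)%MM]] f.
  rewrite /maxideal; congr (ideal_gen _ f); apply/predeqP => g; split.
    by case=> ->; [exists U_(ord0)%MM; [left|] | exists U_(ord_max)%MM;
      [right|]].
  by move=> [m [->|->] <-]; [left|right].
rewrite ideal_gen_monomial; split=> h m /h /=.
  move=> [m' [->|->]] + m0; rewrite m0 => /mnm_lepP.
    by move/(_ ord0); rewrite mnm1E eqxx mnm0E.
  by move/(_ ord_max); rewrite mnm1E eqxx mnm0E.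
move=> m0; have [h0|h0] := eqVneq (m ord0) 0%N; last first.
  exists U_(ord0)%MM; first by left.
  by rewrite lep1mP.
exists U_(ord_max)%MM; first by right.
rewrite lep1mP; apply/eqP => h1; apply: m0.
by apply: mnm2P; rewrite ?h0 ?h1 mnm0E.
Qed.

Variables (d : nat) (M : set 'X_{1..2}).
Hypothesis hM : forall m, M m -> mdeg m = d.
Local Notation I := (ideal_gen [set 'X_[k, m] | m in M]).
Hypotheses (hx : I (vx k ^+ d)) (hxy : I (vx k ^+ d.-1 * vy k))
  (hy : I (vy k ^+ d)).

Definition y_exps (j : nat) : Prop := exists2 m, M m & m ord_max = j.

(** Degree reasons: a generator dividing a monomial of degree d is equal to
it. *)
Lemma mem_gens p q : (p + q = d)%N -> I ('X_[mon p q]) -> y_exps q.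
Proof.
move=> pq /ideal_gen_monomial/(_ (mon p q)); rewrite msuppX inE eqxx.
move=> /(_ isT) [m Mm le]; exists m => //; have := hM Mm; rewrite mdeg2.
have := mnm_lepP le ord0; have := mnm_lepP le ord_max; rewrite mon0E mon1E.
lia.
Qed.

Lemma vxE n : vx k ^+ n = 'X_[mon n 0].
Proof.
rewrite /vx mpolyXn; congr 'X_[_]; apply: mnm2P;
by rewrite mulmnE mnm1E ?mon0E ?mon1E ?mul1n ?mul0n.
Qed.

Lemma vyE n : vy k ^+ n = 'X_[mon 0 n].
Proof.
rewrite /vy mpolyXn; congr 'X_[_]; apply: mnm2P;
by rewrite mulmnE mnm1E ?mon0E ?mon1E ?mul1n ?mul0n.
Qed.

Lemma y_exps0 : y_exps 0.
Proof. by apply: (@mem_gens d 0); [rewrite addn0 | rewrite -vxE]. Qed.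

Lemma y_exps1 : (0 < d)%N -> y_exps 1.
Proof.
move=> d0; apply: (@mem_gens d.-1 1); first by lia.
by have := hxy; rewrite vxE -[vy k]expr1 vyE -mpolyXD monD addn0 add0n.
Qed.

Lemma y_expsd : y_exps d.
Proof. by apply: (@mem_gens 0 d); [rewrite add0n | rewrite -vyE]. Qed.

Lemma y_exps_le j : y_exps j -> (j <= d)%N.
Proof. by move=> [m /hM + <-]; rewrite mdeg2; lia. Qed.

Local Notation SR := (rees_exp d y_exps).
Local Notation SF := (fiber_exp d y_exps).

Lemma rees_exp_upset n :
  mnm_upset [set m : 'X_{1..2} | SR n (m ord0) (m ord_max)].
Proof.
move=> m m' [j [hj jq le]]; exists j; rewrite !mnmDE; split=> //; lia.
Qed.

(** In the inductive step, the divisor of x^p y^q in a generator of I has to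
be complemented in I^n; the bound y <= nd on the exponents leaves enough of
x. *)
Lemma ideal_pow_monomial n f :
  ideal_pow I n f <-> supp_in [set m : 'X_{1..2} | SR n (m ord0) (m ord_max)] f.
Proof.
elim: n f => [|n IH] f.
  by split=> // _ m _; exists 0%N; split.
apply: (iff_trans (ideal_mul_monomial (@ideal_gen_monomial M) IH
  (@rees_exp_upset n) f)).
have h m : mnm_add [set m | exists2 m', M m' & (m' <= m)%MM]
      [set m : 'X_{1..2} | SR n (m ord0) (m ord_max)] m <-> SR n.+1 (m ord0) (m
        ord_max).
  split=> [[u [v [[m' Mm' le] [j [hj jq jp]] ->]]]|].
    exists (m' ord_max + j)%N; rewrite !mnmDE.
    have := hM Mm'; have := mnm_lepP le ord0; have := mnm_lepP le ord_max.
    rewrite mdeg2 mulSn => h1 h2 h3; split; [|lia|lia].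
    by exists (m' ord_max), j; split=> //; exists m'.
  move=> [j [/= [x [y [[m' Mm' mx] hy' ->]]]] jq jp].
  have yn := sumset_le y_exps_le hy'; have md := hM Mm'; rewrite mdeg2 in md.
  rewrite mulSn in jp.
  exists m', (mon (m ord0 - m' ord0) (m ord_max - m' ord_max)); split.
  - by exists m' => //; exact: lepm_refl.
  - by exists y; rewrite mon0E mon1E; split=> //; lia.
  - by apply: mnm2P; rewrite mnmDE ?mon0E ?mon1E; lia.
by split=> hf m /hf/h.
Qed.

(** In degree n, the monomials of m I^n are those of I^n that are not minimal
generators, since all generators of I^n have degree nd. *)
Lemma fiber_ideal_monomial n f :
  ideal_mul (@maxideal k) (ideal_pow I n) f <->
  supp_in [set m : 'X_{1..2} |
    SR n (m ord0) (m ord_max) /\ (n * d < mdeg m)%N] f.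
Proof.
rewrite (ideal_mul_monomial maxideal_monomial (ideal_pow_monomial n)
  (@rees_exp_upset n)).
have h m : mnm_add [set m | m <> 0%MM]
      [set m : 'X_{1..2} | SR n (m ord0) (m ord_max)] m <->
    SR n (m ord0) (m ord_max) /\ (n * d < mdeg m)%N.
  split=> [[u [v [/= u0 hv ->]]]|].
    split; first exact: rees_exp_upset.
    have u1 : (0 < mdeg u)%N by rewrite lt0n mdeg_eq0; apply/eqP.
    by rewrite mdegD; move: hv => [j [_ jq le]]; rewrite (mdeg2 v); lia.
  move=> [[j [hj jq le]]]; rewrite mdeg2 => lt.
  have [jlt|jge] := ltnP j (m ord_max).
    exists (mon 0 1), (mon (m ord0) (m ord_max).-1); split.
    - by move=> /= /(congr1 (fun m : 'X_{1..2} => m ord_max));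
      rewrite mon1E mnm0E.
    - by exists j; rewrite mon0E mon1E; split=> //; lia.
    - by apply: mnm2P; rewrite mnmDE ?mon0E ?mon1E; lia.
  have jn := sumset_le y_exps_le hj.
  exists (mon 1 0), (mon (m ord0).-1 (m ord_max)); split.
  - by move=> /= /(congr1 (fun m : 'X_{1..2} => m ord0)); rewrite mon0E mnm0E.
  - by exists j; rewrite mon0E mon1E; split=> //; lia.
  - by apply: mnm2P; rewrite mnmDE ?mon0E ?mon1E; lia.
by split=> hf m /hf/h.
Qed.

Local Notation rv p := (val (p : rees_algebra I) : {poly P}).

Lemma rees_monomial n f : in_S SR n f ->
  exists2 p : rees I, rees_comp n p & (rv p)`_n = f.
Proof.
move=> /ideal_pow_monomial hf.
have h : rees_pred I (f *: 'X^n).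
  apply/rees_predP => i; rewrite coefZ coefXn; have [->|_] := eqVneq i n.
    by rewrite mulr1.
  by rewrite mulr0; apply: ideal_pow0.
exists (Rees h); last by rewrite /= coefZ coefXn eqxx mulr1.
by move=> m mn; rewrite /= coefZ coefXn (negbTE mn) mulr0.
Qed.

Lemma rees_comp_inj n (u v : rees I) : rees_comp n u -> rees_comp n v ->
  (rv u)`_n = (rv v)`_n -> u = v.
Proof.
move=> hu hv uv; apply: val_inj; apply/polyP => i.
by have [->|ni] := eqVneq i n; rewrite // hu // hv.
Qed.

Lemma rees_coefM i j (u v : rees I) : rees_comp i u -> rees_comp j v ->
  (rv (u * v))`_(i + j) = (rv u)`_i * (rv v)`_j.
Proof.
move=> hu hv; rewrite rmorphM coefM.
have hi : (i < (i + j).+1)%N by rewrite ltnS leq_addr.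
rewrite (bigD1 (Ordinal hi)) //= addKn big1 ?addr0 // => l li.
by rewrite hu ?mul0r //; apply: contra li => /eqP h; apply/eqP/val_inj.
Qed.

Lemma in_S_a : in_S SF 1 'X_[k, mon d 0].
Proof.
by apply/in_S_mon; split; [lia|]; exists 0%N, 0%N; split=> //; exact: y_exps0.
Qed.

Lemma in_S_b : in_S SF 1 'X_[k, mon 0 d].
Proof.
apply/in_S_mon; split; first lia.
by exists d, 0%N; split=> //; [exact: y_expsd | rewrite addn0].
Qed.

Lemma in_S_fiber_rees n f : in_S SF n f -> in_S SR n f.
Proof. by move=> h m /h; exact: fiber_rees_exp. Qed.

Lemma rees_model : exists a b : rees I,
  monomial_model SR (fun n (p : rees I) => (rv p)`_n) d a b.
Proof.
have [a ha aE] := rees_monomial (in_S_fiber_rees in_S_a).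
have [b hb bE] := rees_monomial (in_S_fiber_rees in_S_b).
exists a, b; split=> //.
- by rewrite rmorph1 coef1.
- by move=> n u v _ _; rewrite rmorphD coefD.
- exact: rees_coefM.
- exact: rees_comp_inj.
- by move=> n u _; apply/ideal_pow_monomial/rees_coef.
- exact: rees_monomial.
Qed.
(** f is the representative of q in I^n that is homogeneous of degree nd. *)
Definition fiber_rep n (q : fiber I) (f : P) : Prop :=
  in_S SF n f /\ exists p : rees I,
    [/\ rees_comp n p, fiber_proj I p = q & (rv p)`_n = f].

Lemma fiber_rep_uniq n q f g : fiber_rep n q f -> fiber_rep n q g -> f = g.
Proof.
move=> [hf [p [hp pq pE]]] [hg [p' [hp' p'q p'E]]].
have /fiber_proj0/fiber_predP/(_ n) : fiber_proj I (p - p') = 0.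
  by rewrite rmorphB pq p'q subrr.
rewrite rmorphB coefB pE p'E => /fiber_ideal_monomial h.
apply/eqP; rewrite -subr_eq0 -msupp_eq0; apply/eqP.
case E: (msupp _) => [//|m s]; have hm : m \in msupp (f - g).
  by rewrite E inE eqxx.
have [_] := h m hm; rewrite mdeg2 => lt.
have := msuppB_le hm; rewrite mem_cat.
by move=> /orP[] h'; [have [e _] := hf m h' | have [e _] := hg m h']; lia.
Qed.

Lemma fiber_rep_exists n q : fiber_comp n q -> exists f, fiber_rep n q f.
Proof.
move=> [p hp pq].
have hpn := (ideal_pow_monomial n _).1 (rees_coef p n).
have [f [g [fg [hf hg]]]] := mpoly_split (fun m => mdeg m = n * d)%N (rv p)`_n.
have Sf : in_S SF n f.
  move=> m /hf[/hpn h]; rewrite mdeg2 => e; exact: rees_fiber_exp h.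
have [p' hp' p'E] := rees_monomial (in_S_fiber_rees Sf).
exists f; split=> //; exists p'; split=> //; rewrite -pq; apply/eqP.
rewrite eq_sym -subr_eq0 -rmorphB; apply/eqP/fiber_proj0/fiber_predP => i.
rewrite rmorphB coefB; have [->|ni] := eqVneq i n; last first.
  by rewrite hp // hp' // subrr; apply: ideal_gen0.
rewrite p'E fg addrAC subrr add0r; apply/fiber_ideal_monomial => m /hg[/hpn h].
move=> ne; split=> //; rewrite ltn_neqAle eq_sym; apply/andP; split.
  by apply/eqP.
by rewrite mdeg2; case: h => [j [_ jq le]]; lia.
Qed.

Lemma fiber_rep_comp n q f : fiber_rep n q f -> fiber_comp n q.
Proof. by move=> [_ [p [hp pq _]]]; exists p. Qed.

Lemma fiber_model : exists phi a b,
  @monomial_model k (fiber I) SF phi d a b.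
Proof.
have /choice[phi0 hphi] : forall x : nat * fiber I, exists f,
    fiber_comp x.1 x.2 -> fiber_rep x.1 x.2 f.
  move=> [n q]; have [/fiber_rep_exists[f hf]|h] := pselect (fiber_comp n q).
    by exists f.
  by exists 0 => /h.
pose phi n q := phi0 (n, q).
have phiP n q : fiber_comp n q -> fiber_rep n q (phi n q)
  by apply: (hphi (n, q)).
have phiE n q f : fiber_rep n q f -> phi n q = f.
  by move=> h; exact: fiber_rep_uniq (phiP _ _ (fiber_rep_comp h)) h.
have surj n f : in_S SF n f -> exists2 q, fiber_comp n q & phi n q = f.
  move=> hf; have [p hp pE] := rees_monomial (in_S_fiber_rees hf).
  have h : fiber_rep n (fiber_proj I p) f by split=> //; exists p.
  by exists (fiber_proj I p); [exact: fiber_rep_comp h | exact: phiE].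
have [a ha aE] := surj _ _ in_S_a; have [b hb bE] := surj _ _ in_S_b.
exists phi, a, b; split=> //.
- apply: phiE; split.
    move=> m; rewrite msupp1 inE => /eqP ->.
    by rewrite !mnm0E; split.
  exists 1; split; [exact: rees_comp1 | exact: rmorph1 |].
  by rewrite rmorph1 coef1.
- move=> n u v /phiP[Su [p [hp pu pE]]] /phiP[Sv [p' [hp' pv p'E]]].
  apply: phiE; split; first exact: in_SD.
  exists (p + p'); split; last by rewrite rmorphD coefD pE p'E.
    exact: (@gr_int_compD (rees I) n).
  by rewrite rmorphD pu pv.
- move=> i j u v /phiP[Su [p [hp pu pE]]] /phiP[Sv [p' [hp' pv p'E]]].
  apply: phiE; split; last first.
    exists (p * p'); split; first exact: rees_compM.
      by rewrite rmorphM pu pv.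
    by rewrite rees_coefM // pE p'E.
  move=> m /msuppM_le/allpairsP[[m1 m2] /= [/Su[e1 s1] /Sv[e2 s2] ->]].
  rewrite !mnmDE; split; first by rewrite mulnDl; lia.
  exact: sumsetD.
- move=> n u v /phiP[_ [p [hp pu pE]]] /phiP[_ [p' [hp' pv p'E]]] uv.
  rewrite -pu -pv; congr (fiber_proj I _); apply: (rees_comp_inj hp hp').
  by rewrite pE p'E.
- by move=> n u /phiP[].
Qed.
End MonomialIdeals.

Theorem theorem4p4 (k : fieldType) (d : nat) (hd : (2 <= d)%N)
    (M : set 'X_{1..2}) (hM : forall m, M m -> mdeg m = d)
    (I : set {mpoly k[2]}) (hI : I = ideal_gen [set 'X_[m] | m in M])
    (hx : I (vx k ^+ d)) (hxy : I (vx k ^+ d.-1 * vy k)) (hy : I (vy k ^+ d))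
    (E : injective_resolution (regular_module (rees I)))
    (E' : injective_resolution (regular_module (fiber I))) :
  exists r : option int, is_regularity E r /\ is_regularity E' r.
Proof.
subst I; pose B := y_exps M.
have Ble : forall j, B j -> (j <= d)%N := y_exps_le hM.
have B0 : B 0%N := y_exps0 hM hx.
have B1 : B 1%N := y_exps1 hM hxy (ltnW hd).
have Bd : B d := y_expsd hM hy.
have [a [b rees_ab]] := rees_model hM hx hy.
have [phi [a' [b' fiber_ab]]] := fiber_model hM hx hy.
have sat_iff := sat_gap_fiber_rees Ble B0 B1 Bd hd.
have end_iff := end_gap_iff Ble B0 B1 Bd hd.
have sat_bound := sat_gap_bound Ble B0 B1 Bd hd.
have end0 : end_gap (fiber_exp d B) d 0 1 := end_gap_fiber0 B0 B1 hd.
have pair_rees : cech_pair a b.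
  apply: (model_cech_pair rees_ab); exists (d * d)%N.
    by move=> n p q; apply: rees_exp_reduction.
  (* A failure for the Rees algebra is a gap, hence a gap of the fiber ring. *)
  move=> n r p q nN h1 h2; apply: contrapT => nS.
  have [t [p' [q' [g1 _ gS]]]] : sat_gap (fiber_exp d B) d n.
    by apply/sat_iff; exists r, p, q.
  by apply: gS; apply: fiber_exp_saturated g1.
have pair_fiber : cech_pair a' b'.
  apply: (model_cech_pair fiber_ab); exists (d * d)%N.
    by move=> n p q; apply: fiber_exp_reduction.
  by move=> n r p q nN h1 _; apply: fiber_exp_saturated h1.
apply: (regularity_transfer (N := (d * d)%N) E E' pair_rees pair_fiber).
- by move=> n; rewrite (model_cech1 rees_ab) (model_cech1 fiber_ab) sat_iff.
- by move=> n; rewrite (model_cech2 rees_ab) (model_cech2 fiber_ab) end_iff.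
- by apply: (model_cech2_m1 rees_ab); apply: end_gap_fiber_rees.
- exact: (model_cech2_m1 fiber_ab).
- by move=> n /(model_cech1 rees_ab)/sat_bound.
- by move=> n /(model_cech2 rees_ab)[t]; apply: end_gap_bound.
Qed.
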